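(* For $0<\lambda\leq 1/128$, define $W_\lambda\colon[0,1]^2\to\mathbb{R}$ by \[ W_\lambda(x,y)=\frac12+\frac{\cos(\pi x)+\cos(\pi y)}8+\frac{\cos(\pi x)\cos(\pi y)}{16}+\sum_{n=2}^{\infty}\lambda^n\cos(n\pi x)\cos(n\pi y). \] There exists a finite family $\mathscr{F}$ of finite simple graphs, independent of $\lambda$, such that for every $\lambda\in(0,1/128]$ and every kernel $U$ satisfying \[ t(F,U)=t(F,W_\lambda)\qquad\text{for all }F\in\mathscr{F}, \] there is a measure-preserving map $\varphi\colon[0,1]\to[0,1]$ such that \[ U(x,y)=W_\lambda(\varphi(x),\varphi(y))\qquad\text{for almost every }(x,y)\in[0,1]^2 . \]
   Context: A kernel is a bounded symmetric measurable function $[0,1]^2\to\mathbb{R}$. For a kernel $W$ and a finite simple graph $F$, the homomorphism density of $F$ in $W$ is \[ t(F,W)=\int_{[0,1]^{V(F)}}\prod_{ij\in E(F)}W(x_i,x_j)\prod_{i\in V(F)}\mathrm{d}x_i . \] A measurable map $\varphi\colon[0,1]\to[0,1]$ is measure preserving if $\operatorname{Leb}(\varphi^{-1}(A))=\operatorname{Leb}(A)$ for every measurable $A\subseteq[0,1]$, where $\operatorname{Leb}$ is Lebesgue measure on $[0,1]$. *)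

(* Defs.v *)
(* "Measurable" means Borel measurable throughout. *)
From HB Require Import structures.
From mathcomp Require Import all_boot all_order all_algebra.
From mathcomp Require Import all_classical all_reals all_analysis.

Set Implicit Arguments.
Unset Strict Implicit.
Unset Printing Implicit Defensive.

Import Order.TTheory GRing.Theory Num.Theory.
Import numFieldNormedType.Exports.

Local Open Scope classical_set_scope.
Local Open Scope ring_scope.

Record sgraph := SGraph {
  vertex : finType;
  adj : rel vertex;
  adj_sym : symmetric adj;
  adj_irrefl : irreflexive adj }.

Definition unitI (R : realType) : set R := `[0, 1].
Arguments unitI {R}.

Lemma measurable_unitI (R : realType) : measurable (@unitI R).
Proof. exact: measurable_itv. Qed.

(* Lebesgue measure on [0, 1], as a Borel probability measure on R carried by
   [0, 1]: A |-> lebesgue_measure (A `&` [0, 1]). *)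
Definition leb01 (R : realType) : set (measurableTypeR R) -> \bar R :=
  @mrestr _ (measurableTypeR R) _ _ (@lebesgue_measure R) (@measurable_unitI R).

HB.instance Definition _ (R : realType) := Measure.on (@leb01 R).

Lemma leb01_setT (R : realType) : @leb01 R setT = 1%E.
Proof.
by rewrite /leb01 /mrestr setTI /unitI lebesgue_measure_itv/= lte01 sube0.
Qed.

HB.instance Definition _ (R : realType) :=
  Measure_isProbability.Build _ _ _ (@leb01 R) (@leb01_setT R).

Definition tcons (T : Type) (n : nat) (p : T * n.-tuple T) : n.+1.-tuple T :=
  [tuple of p.1 :: p.2].

Lemma measurable_tcons (R : realType) (n : nat) :
  measurable_fun [set: measurableTypeR R * n.-tuple (measurableTypeR R)]
    (@tcons (measurableTypeR R) n).
Proof. exact: measurable_cons. Qed.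

HB.instance Definition _ (R : realType) (n : nat) :=
  isMeasurableFun.Build _ _
    (measurableTypeR R * n.-tuple (measurableTypeR R))%type
    (n.+1.-tuple (measurableTypeR R))
    (@tcons (measurableTypeR R) n) (@measurable_tcons R n).

(* The n-fold product of leb01, on n-tuples of reals: leb01^(n+1) is
   leb01 \x leb01^n transported along (x, t) |-> x :: t. *)
Fixpoint leb01n (R : realType) (n : nat) :
    probability (n.-tuple (measurableTypeR R)) R :=
  match n with
  | 0 => dirac ([tuple] : 0.-tuple (measurableTypeR R))
  | n'.+1 => distribution (@leb01 R \x leb01n R n')%E (@tcons (measurableTypeR R) n')
  end.

(* Together with the pi-lambda theorem, this pins down leb01n. *)
Lemma leb01n_box (R : realType) (n : nat) (A : 'I_n -> set (measurableTypeR R)) :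
  (forall i, measurable (A i)) ->
  leb01n R n [set t | forall i, A i (tnth t i)] = (\prod_(i < n) leb01 (A i))%E.
Proof.
elim: n A => [|n IHn] A mA.
  by rewrite big_ord0 /= diracE mem_set// => -[].
rewrite big_ord_recl -IHn// -product_measure1E//=; last first.
  rewrite (_ : [set t | _] =
      \bigcap_i ((@tnth n R ^~ i) @^-1` A (lift ord0 i))); last first.
    by apply/seteqP; split=> t /= H i => [_|]; exact: H.
  apply: fin_bigcap_measurable => // i _.
  by rewrite -[X in measurable X]setTI; exact: measurable_tnth.
rewrite /distribution /pushforward; congr (_ _).
apply/seteqP; split=> -[x t] /=.
  move=> H; split=> [|i]; first by have := H ord0; rewrite tnth0.
  by have := H (lift ord0 i); rewrite tnthS.
move=> [H0 H] i; case: (unliftP ord0 i) => [j|] ->; last by rewrite tnth0.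
by rewrite tnthS; exact: H.
Qed.

Definition cube (R : realType) (n : nat) : set (n.-tuple R) :=
  [set x | forall i, unitI (tnth x i)].
Arguments cube {R} n.

(* A function on [0, 1]^2 is represented by a function on R^2 whose values
   outside [0, 1]^2 are ignored. *)
Definition is_kernel (R : realType) (W : R -> R -> R) : Prop :=
  [/\ measurable_fun (unitI `*` unitI) (fun z : R * R => W z.1 z.2),
      exists M : R, forall x y, unitI x -> unitI y -> `|W x y| <= M
    & forall x y, unitI x -> unitI y -> W x y = W y x].

(* The coordinate of vertex i is number (enum_rank i) of the tuple; the
   condition on ranks makes each edge be counted once. *)
Definition hom_density (R : realType) (F : sgraph) (W : R -> R -> R) : R :=
  \int[leb01n R #|vertex F|]_(x in cube #|vertex F|)
    \prod_(e : vertex F * vertex F |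
           adj e.1 e.2 && (enum_rank e.1 < enum_rank e.2)%N)
      W (tnth x (enum_rank e.1)) (tnth x (enum_rank e.2)).

Definition measure_preserving (R : realType) (phi : R -> R) : Prop :=
  [/\ forall x, unitI x -> unitI (phi x),
      measurable_fun unitI phi
    & forall A : set R, measurable A -> A `<=` unitI ->
        lebesgue_measure (unitI `&` phi @^-1` A) = lebesgue_measure A].

Definition Wl (R : realType) (lambda x y : R) : R :=
  1 / 2 + (cos (pi * x) + cos (pi * y)) / 8
  + cos (pi * x) * cos (pi * y) / 16
  + \big[+%R/0]_(2 <= n <oo)
      (lambda ^+ n * cos (n%:R * pi * x) * cos (n%:R * pi * y)).

(* Main.v *)
From HB Require Import structures.
Require Import Defs.
From mathcomp Require Import all_boot all_order all_algebra.
From mathcomp Require Import all_classical all_reals all_analysis.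
From mathcomp Require Import measurable_realfun.
From mathcomp Require Import ring lra.

Set Implicit Arguments.
Unset Strict Implicit.
Unset Printing Implicit Defensive.

Import Order.TTheory GRing.Theory Num.Theory.
Import numFieldNormedType.Exports.

Local Open Scope classical_set_scope.
Local Open Scope ring_scope.

(** The function h = 8 d - 4, where d is the degree function of a kernel, equals
cos (pi x) for the kernel W_lambda, and for a kernel U it can be written with
pendant edges.  Hence, for any polynomial expression in U(x, y), h(x), h(y) that
is linear in U(x, y), its densities are linear combinations of densities of
simple graphs in U.

Adding to 2 W_lambda a correction in 1, cos (pi x), cos (pi y) and their product
yields K = 1 + 2 sum_(n >= 1) lambda^n cos (n pi x) cos (n pi y), a symmetrised
Poisson kernel.  It has a closed form K Q(h(x), h(y)) = P(h(x), h(y)), where P and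
Q are polynomials and Q is positive on [-1, 1]^2 ([Wl_closed]).  The difference
of the two sides is called [defect]; its four-cycle density is a combination of
densities of graphs with at most 20 vertices, with coefficients depending on
lambda, so it vanishes for U as well.  A function with zero four-cycle density is
zero almost everywhere ([codegree_eq0]), so U satisfies the same closed form
([forced_defect]).  In the same way U inherits the two moments int h = 0 and
int h^2 = 1/2, and the identity U h = 1/16 + h/32 ([forced_mean],
[forced_square], [forced_eigen]).  The family consists of all graphs on at most
20 vertices.

It remains to find the distribution of h.  Let D be the integral operator of the
kernel K built from U, let M be multiplication by h, and T_n the Chebyshev
polynomials.  Read as an operator identity, the closed form gives D M^2 p in terms
of D p and D M p, up to terms which vanish when p is orthogonal to 1 and h
([ker_op_relation]).  Starting from D 1 = 1 and D h = lambda h, this determines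
D T_n(h) recursively, and the answer is the one for the cosine:
D T_n(h) = lambda^n T_n(h) ([eigen_all]).  The orthogonality needed at each step
comes from the symmetry of D and the distinctness of the eigenvalues already
found.  In particular int T_n(h) = 0 for n >= 1, so h has the moments of
cos (pi x), and, being bounded, the same distribution ([eq_law_of_moments]).  So
phi = arccos(h) / pi preserves the measure, h = cos (pi phi) almost everywhere,
and dividing the closed form by Q gives U = W_lambda(phi, phi). *)

(** * Bounded measurable functions on probability spaces *)

(** Every function integrated below is bounded and measurable on the whole
space, so that integrability never has to be discussed and linearity and
Fubini hold without side conditions on the integrals. *)
Definition bmeas {d} {T : measurableType d} {R : realType} (f : T -> R) : Prop :=
  measurable_fun setT f /\ exists M : R, forall x, `|f x| <= M.

Section BoundedMeasurable.
Context {d} {T : measurableType d} {R : realType}.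
Implicit Types f g : T -> R.

Lemma bmeas_cst (c : R) : bmeas (fun _ : T => c).
Proof. by split; [exact: measurable_cst | exists `|c|]. Qed.

Lemma bmeasD f g : bmeas f -> bmeas g -> bmeas (fun x => f x + g x).
Proof.
move=> [mf [M Mf]] [mg [N Ng]]; split; first exact: measurable_funD.
by exists (M + N) => x; rewrite (le_trans (ler_normD _ _))// lerD.
Qed.

Lemma bmeasM f g : bmeas f -> bmeas g -> bmeas (fun x => f x * g x).
Proof.
move=> [mf [M Mf]] [mg [N Ng]]; split; first exact: measurable_funM.
by exists (M * N) => x; rewrite normrM ler_pM.
Qed.

Lemma bmeasZ (c : R) f : bmeas f -> bmeas (fun x => c * f x).
Proof. by move=> bf; apply: bmeasM => //; exact: bmeas_cst. Qed.

Lemma bmeasN f : bmeas f -> bmeas (fun x => - f x).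
Proof.
move=> bf; rewrite (_ : (fun x => _) = (fun x => -1 * f x)).
  exact: bmeasZ.
by apply/funext => x; rewrite mulN1r.
Qed.

Lemma bmeasB f g : bmeas f -> bmeas g -> bmeas (fun x => f x - g x).
Proof. by move=> bf bg; apply: bmeasD => //; exact: bmeasN. Qed.

Lemma bmeasX f n : bmeas f -> bmeas (fun x => f x ^+ n).
Proof.
move=> bf; elim: n => [|n IHn]; first exact: bmeas_cst.
rewrite (_ : (fun x => _) = (fun x => f x * f x ^+ n)); first exact: bmeasM.
by apply/funext => x; rewrite exprS.
Qed.

Lemma bmeas_sum (I : Type) (s : seq I) (F : I -> T -> R) :
  (forall i, bmeas (F i)) -> bmeas (fun x => \sum_(i <- s) F i x).
Proof.
move=> bF; elim: s => [|i s IHs].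
  rewrite (_ : (fun x => _) = fun=> 0); first exact: bmeas_cst.
  by apply/funext => x; rewrite big_nil.
rewrite (_ : (fun x => _) = fun x => F i x + \sum_(j <- s) F j x).
  exact: bmeasD.
by apply/funext => x; rewrite big_cons.
Qed.

Lemma bmeas_prod (I : Type) (s : seq I) (F : I -> T -> R) :
  (forall i, bmeas (F i)) -> bmeas (fun x => \prod_(i <- s) F i x).
Proof.
move=> bF; elim: s => [|i s IHs].
  rewrite (_ : (fun x => _) = fun=> 1); first exact: bmeas_cst.
  by apply/funext => x; rewrite big_nil.
rewrite (_ : (fun x => _) = fun x => F i x * \prod_(j <- s) F j x).
  exact: bmeasM.
by apply/funext => x; rewrite big_cons.
Qed.

Lemma bmeas_indic (A : set T) : measurable A -> bmeas (\1_A : T -> R).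
Proof.
move=> mA; split; first exact: measurable_indic.
exists 1 => x; rewrite indicE; case: (_ \in _); rewrite ?normr1 ?normr0//.
Qed.

End BoundedMeasurable.

Lemma bmeas_comp {d d'} {T : measurableType d} {T' : measurableType d'}
    {R : realType} (f : T -> R) (g : T' -> T) :
  bmeas f -> measurable_fun setT g -> bmeas (f \o g).
Proof.
move=> [mf [M Mf]] mg; split; first exact: measurableT_comp.
by exists M => x /=.
Qed.

Section BoundedIntegral.
Context {d} {T : measurableType d} {R : realType} (P : probability T R).
Implicit Types f g : T -> R.

Lemma bmeas_integrable f : bmeas f -> P.-integrable setT (EFin \o f).
Proof.
move=> [mf [M Mf]]; apply: measurable_bounded_integrable => //.
  by apply: le_lt_trans (ltry 1); exact: probability_le1. 
by exists M; split; [exact: num_real | move=> N MN x _; exact: le_trans (Mf x) (ltW MN)].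
Qed.

(** Monotonicity of the almost-everywhere filter, with the measure packed as a
probability: for product measures the filter instance is not inferred from the
notation alone. *)
Lemma aeS (Q Q' : T -> Prop) : (forall x, Q x -> Q' x) ->
  {ae P, forall x, Q x} -> {ae P, forall x, Q' x}.
Proof. by move=> QQ; apply: filterS. Qed.

Lemma aeS2 (Q Q' Q'' : T -> Prop) : (forall x, Q x -> Q' x -> Q'' x) ->
  {ae P, forall x, Q x} -> {ae P, forall x, Q' x} -> {ae P, forall x, Q'' x}.
Proof. by move=> QQ; apply: filterS2. Qed.

Lemma bint_cst (c : R) : \int[P]_x c = c.
Proof.
rewrite Rintegral_cst// -[RHS]mulr1; congr (_ * _).
exact: (congr1 fine (@probability_setT _ _ _ P)).
Qed.

Lemma bintD f g : bmeas f -> bmeas g ->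
  \int[P]_x (f x + g x) = \int[P]_x f x + \int[P]_x g x.
Proof. by move=> bf bg; rewrite RintegralD//; exact: bmeas_integrable. Qed.

Lemma bintB f g : bmeas f -> bmeas g ->
  \int[P]_x (f x - g x) = \int[P]_x f x - \int[P]_x g x.
Proof. by move=> bf bg; rewrite RintegralB//; exact: bmeas_integrable. Qed.

Lemma bintZ (c : R) f : bmeas f -> \int[P]_x (c * f x) = c * \int[P]_x f x.
Proof. by move=> bf; rewrite RintegralZl//; exact: bmeas_integrable. Qed.

Lemma bint_sum (I : Type) (s : seq I) (F : I -> T -> R) :
  (forall i, bmeas (F i)) ->
  \int[P]_x (\sum_(i <- s) F i x) = \sum_(i <- s) \int[P]_x F i x.
Proof.
move=> bF; elim: s => [|i s IHs].
  rewrite big_nil -[RHS](bint_cst 0); apply: eq_Rintegral => x _.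
  by rewrite big_nil.
rewrite big_cons -IHs -bintD//; last exact: bmeas_sum.
by apply: eq_Rintegral => x _; rewrite big_cons.
Qed.

Lemma le_bint f g : bmeas f -> bmeas g -> (forall x, f x <= g x) ->
  \int[P]_x f x <= \int[P]_x g x.
Proof. by move=> bf bg fg; apply: le_Rintegral => //; exact: bmeas_integrable. Qed.

Lemma bint_indic (A : set T) : measurable A -> \int[P]_x (\1_A x : R) = fine (P A).
Proof. by move=> mA; rewrite /Rintegral integral_indic// setIT. Qed.

Lemma bint_le_bound f (M : R) : bmeas f -> (forall x, `|f x| <= M) ->
  `|\int[P]_x f x| <= M.
Proof.
move=> bf Mf; rewrite (le_trans (le_normr_Rintegral _ _))//.
  exact: bmeas_integrable.
rewrite -[leRHS]bint_cst; apply: le_bint => //; last exact: bmeas_cst.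
by case: bf => mf [N Nf]; split; [exact: measurableT_comp|exists N => x; rewrite normr_id].
Qed.

Lemma bint_ae_eq f g : bmeas f -> bmeas g -> {ae P, forall x, f x = g x} ->
  \int[P]_x f x = \int[P]_x g x.
Proof.
move=> [mf _] [mg _] fg; congr fine; apply: ae_eq_integral => //.
- exact/measurable_EFinP.
- exact/measurable_EFinP.
- by apply: filterS fg => x -> .
Qed.

Lemma bint_eq0 f : bmeas f -> (forall x, 0 <= f x) -> \int[P]_x f x = 0 ->
  {ae P, forall x, f x = 0}.
Proof.
move=> bf f0 if0.
have mf : measurable_fun setT (EFin \o f) by apply/measurable_EFinP; case: bf.
have : (\int[P]_x `|(EFin \o f) x|)%E = 0%E.
  have -> : (\int[P]_x `|(EFin \o f) x|)%E = (\int[P]_x (f x)%:E)%E.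
    by apply: eq_integral => x _ /=; rewrite ger0_norm.
  rewrite -(@fineK _ (\int[P]_x (f x)%:E)%E) ?if0//.
    by move: if0; rewrite /Rintegral => ->.
  exact: integrable_fin_num (bmeas_integrable bf).
move/(ae_eq_integral_abs P measurableT mf); apply: filterS => x /(_ I) /=.
by case.
Qed.

Lemma bint_sqr_eq0 f : bmeas f -> \int[P]_x f x ^+ 2 = 0 ->
  {ae P, forall x, f x = 0}.
Proof.
move=> bf if0; have := bint_eq0 (bmeasX 2 bf) (fun x => sqr_ge0 (f x)) if0.
by apply: filterS => x /eqP; rewrite sqrf_eq0 => /eqP.
Qed.

Lemma bint_square f : bmeas f ->
  \int[P]_y \int[P]_x (f x * f y) = (\int[P]_x f x) ^+ 2.
Proof.
move=> bf; rewrite expr2 -(bintZ _ bf); apply: eq_Rintegral => y _.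
by rewrite [RHS]mulrC -(bintZ _ bf); apply: eq_Rintegral => x _; rewrite mulrC.
Qed.

End BoundedIntegral.

Section BoundedFubini.
Context {d1 d2} {T1 : measurableType d1} {T2 : measurableType d2} {R : realType}.
Variables (P1 : probability T1 R) (P2 : probability T2 R).
Variable f : T1 * T2 -> R.
Hypothesis bf : bmeas f.

Lemma bmeas_section1 x : bmeas (fun y => f (x, y)).
Proof.
exact: (bmeas_comp bf (pair1_measurable x)).
Qed.

Lemma bmeas_section2 y : bmeas (fun x => f (x, y)).
Proof.
exact: (bmeas_comp bf (pair2_measurable y)).
Qed.

Let intf : (P1 \x P2)%E.-integrable setT (EFin \o f).
Proof. exact: bmeas_integrable. Qed.

Lemma bmeas_int2 : bmeas (fun x => \int[P2]_y f (x, y)).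
Proof.
split.
  have := measurable_fubini_F intf; rewrite /fubini_F => mF.
  by apply: (measurableT_comp (f := fine)) => //.
case: (bf) => _ [M Mf]; exists M => x; apply: bint_le_bound => //.
exact: bmeas_section1.
Qed.

Lemma bmeas_int1 : bmeas (fun y => \int[P1]_x f (x, y)).
Proof.
split.
  have := measurable_fubini_G intf; rewrite /fubini_G => mF.
  by apply: (measurableT_comp (f := fine)) => //.
case: (bf) => _ [M Mf]; exists M => x; apply: bint_le_bound => //.
exact: bmeas_section2.
Qed.

Lemma bint_prod12 : \int[(P1 \x P2)%E]_z f z = \int[P1]_x \int[P2]_y f (x, y).
Proof.
rewrite /Rintegral -(integral12_prod_meas1 intf); congr fine.
apply: eq_integral => x _; rewrite /fubini_F fineK//.
exact: integrable_fin_num (bmeas_integrable _ (bmeas_section1 x)).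
Qed.

Lemma bint_prod21 : \int[(P1 \x P2)%E]_z f z = \int[P2]_y \int[P1]_x f (x, y).
Proof.
rewrite /Rintegral -(integral21_prod_meas1 intf); congr fine.
apply: eq_integral => x _; rewrite /fubini_G fineK//.
exact: integrable_fin_num (bmeas_integrable _ (bmeas_section2 x)).
Qed.

Lemma bint_swap :
  \int[P1]_x \int[P2]_y f (x, y) = \int[P2]_y \int[P1]_x f (x, y).
Proof. by rewrite -bint_prod12 bint_prod21. Qed.

End BoundedFubini.

(** * The four-cycle density detects zero *)
Section VanishingOnRectangles.
Context {d1 d2} {T1 : measurableType d1} {T2 : measurableType d2} {R : realType}.
Variables (P1 : probability T1 R) (P2 : probability T2 R).
Local Notation P12 := (P1 \x P2)%E.

(** The sets over which f integrates to 0 form a Dynkin class; it contains the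
rectangles, hence all measurable sets. *)
Lemma ae_eq0_of_rectangles (f : T1 * T2 -> R) : bmeas f ->
  (forall A B, measurable A -> measurable B ->
     \int[P1]_x \int[P2]_y (\1_A x * \1_B y * f (x, y)) = 0) ->
  {ae P12, forall z, f z = 0}.
Proof.
move=> bf f0.
have intf : P12.-integrable setT (EFin \o f) by exact: bmeas_integrable.
have mf : measurable_fun setT (EFin \o f) by exact: measurable_int intf.
have int0 S : measurable S -> (\int[P12]_(z in S) (EFin \o f) z = 0)%E.
  rewrite measurable_prod_measurableType.
  have rect A B : measurable A -> measurable B ->
      (\int[P12]_(z in A `*` B) (EFin \o f) z = 0)%E.
    move=> mA mB; have mAB : measurable (A `*` B) by exact: measurableX.
    have bg : bmeas (fun z => \1_(A `*` B) z * f z).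
      by apply: bmeasM => //; exact: bmeas_indic.
    rewrite integral_mkcond.
    have -> : ((EFin \o f) \_ (A `*` B))%E = EFin \o (fun z => \1_(A `*` B) z * f z).
      apply/funext => z; rewrite /= /patch indicE; case: ifPn => _ /=.
        by rewrite mul1r.
      by rewrite mul0r.
    rewrite -[LHS]fineK; last exact: integrable_fin_num (bmeas_integrable _ bg).
    congr (_ %:E); rewrite -[LHS]/(\int[P12]_z (\1_(A `*` B) z * f z)).
    rewrite (bint_prod12 P1 P2 bg) -[RHS](f0 _ _ mA mB).
    apply: eq_Rintegral => x _; apply: eq_Rintegral => y _.
    by rewrite !indicE in_setX/= -natrM mulnb.
  apply: (dynkin_induction
    (G := [set A `*` B | A in @measurable _ T1 & B in @measurable _ T2])
    (P := fun S => (\int[P12]_(z in S) (EFin \o f) z = 0)%E)).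
  - exact: measurable_prod_measurableType.
  - move=> _ _ [A1 mA1 [A2 mA2 <-]] [B1 mB1 [B2 mB2 <-]].
    exists (A1 `&` B1); first exact: measurableI.
    by exists (A2 `&` B2); [exact: measurableI | rewrite setXI].
  - by rewrite -setXTT rect.
  - by move=> _ [A mA [B mB <-]]; exact: rect.
  - move=> C mC C0.
    have : (\int[P12]_(z in C `|` ~` C) (EFin \o f) z = 0)%E.
      by rewrite setUv -setXTT rect.
    rewrite integral_setU//= ?setUv//.
    + by rewrite C0 add0e.
    + exact: measurableC.
    + by apply/disj_setPS => z [].
  - move=> F mF tF F0; rewrite integral_bigcup//.
      by rewrite eseries0.
    by apply: integrableS intf => //; exact: bigcup_measurable.
have := integral_ae_eq measurableT intf (g := cst 0%E) (measurable_cst _).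
move=> /(_ _)[].
  by move=> S _ mS; rewrite int0// integral0.
by move=> N [mN N0 fN]; exists N; split => // z /= nfz; apply: fN => /= /(_ I) [].
Qed.

End VanishingOnRectangles.

Section FourCycle.
Context {d1 d2} {T1 : measurableType d1} {T2 : measurableType d2} {R : realType}.
Variables (P1 : probability T1 R) (P2 : probability T2 R).

(** The hypothesis is the density of the four-cycle in f.  It says that the
codegree g of f vanishes almost everywhere.  The integral of g against
1_B (u) 1_B (v) is the integral over z of the square of the integral of f (z, _)
over B, so f integrates to 0 over all rectangles.  Squaring f itself
would be simpler, but a square of the kernel is the density of a multigraph. *)
Lemma codegree_eq0 (f : T1 * T2 -> R) : bmeas f ->
  \int[P2]_v \int[P2]_u (\int[P1]_z (f (z, u) * f (z, v))) ^+ 2 = 0 ->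
  {ae (P1 \x P2)%E, forall z, f z = 0}.
Proof.
move=> bf C40.
pose g (w : T2 * T2) := \int[P1]_z (f (z, w.2) * f (z, w.1)).
have bg0 : bmeas (fun p : T1 * (T2 * T2) => f (p.1, p.2.2) * f (p.1, p.2.1)).
  apply: bmeasM; apply: (bmeas_comp bf); apply: measurable_fun_pair => //.
    exact: (measurableT_comp measurable_snd measurable_snd).
  exact: (measurableT_comp measurable_fst measurable_snd).
have bg : bmeas g by exact: (bmeas_int1 P1 (P2 \x P2)%E bg0).
have g0 : {ae (P2 \x P2)%E, forall w, g w = 0}.
  by apply: bint_sqr_eq0 => //; rewrite bint_prod12//; exact: bmeasX.
apply: ae_eq0_of_rectangles => // A B mA mB.
have bB : bmeas (fun p : T1 * T2 => \1_B p.2 * f p).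
  by apply: bmeasM => //; apply: (bmeas_comp (bmeas_indic mB)).
pose h x := \int[P2]_y (\1_B y * f (x, y)).
have bh : bmeas h by exact: (bmeas_int2 P1 P2 bB).
have h0 : {ae P1, forall x, h x = 0}.
  apply: bint_sqr_eq0 => //.
  have bI : bmeas (fun w : T2 * T2 => \1_B w.2 * \1_B w.1 : R).
    by apply: bmeasM; apply: (bmeas_comp (bmeas_indic mB)).
  have bI' : bmeas (fun p : T1 * (T2 * T2) =>
      \1_B p.2.2 * \1_B p.2.1 * (f (p.1, p.2.2) * f (p.1, p.2.1))).
    by apply: bmeasM => //; exact: (bmeas_comp bI measurable_snd).
  transitivity (\int[P1]_x \int[(P2 \x P2)%E]_w
      (\1_B w.2 * \1_B w.1 * (f (x, w.2) * f (x, w.1)))).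
    apply: eq_Rintegral => x _.
    rewrite (bint_prod12 P2 P2 (bmeas_section1 bI' x)) /=.
    have bBx : bmeas (fun y => \1_B y * f (x, y)) := bmeas_section1 bB x.
    rewrite expr2 -/(h x) {1}/h -bintZ//; apply: eq_Rintegral => v _.
    rewrite mulrC -bintZ//; apply: eq_Rintegral => u _; ring.
  rewrite (bint_swap P1 (P2 \x P2)%E bI') /=.
  rewrite -[RHS](bint_cst (P2 \x P2)%E 0); apply: bint_ae_eq.
  - exact: (bmeas_int1 P1 (P2 \x P2)%E bI').
  - exact: bmeas_cst.
  - apply: filterS g0 => w gw0.
    rewrite bintZ; first by rewrite -/(g w) gw0 mulr0.
    exact: (bmeas_section2 bg0 w).
transitivity (\int[P1]_x (\1_A x * h x)).
  apply: eq_Rintegral => x _; rewrite -bintZ; last exact: (bmeas_section1 bB x).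
  by apply: eq_Rintegral => y _; rewrite mulrA.
rewrite -[RHS](bint_cst P1 0); apply: bint_ae_eq.
- by apply: bmeasM => //; exact: bmeas_indic.
- exact: bmeas_cst.
- by apply: filterS h0 => x ->; rewrite mulr0.
Qed.

End FourCycle.

(** * Bounded random variables are determined by their moments *)
Section SharpPolynomial.
Context {R : realFieldType}.
Implicit Types z y : R.

Lemma bernoulli_sub z m : 0 <= z <= 1 -> 1 - m%:R * z <= (1 - z) ^+ m.
Proof.
move=> /andP[z0 z1]; elim: m => [|m IHm]; first by rewrite mul0r subr0 expr0.
rewrite exprS (le_trans _ (ler_wpM2l _ IHm)) ?subr_ge0//.
have : 0 <= m%:R * z ^+ 2 by rewrite mulr_ge0// sqr_ge0.
rewrite -natr1; nra.
Qed.

Lemma bernoulli_add z m : 0 <= z -> 1 + m%:R * z <= (1 + z) ^+ m.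
Proof.
move=> z0; elim: m => [|m IHm]; first by rewrite mul0r addr0 expr0.
rewrite exprS (le_trans _ (ler_wpM2l _ IHm)) ?addr_ge0//.
have : 0 <= m%:R * z ^+ 2 by rewrite mulr_ge0// sqr_ge0.
rewrite -natr1; nra.
Qed.

Lemma bernoulli_inv z m : 0 <= z <= 1 -> (1 - z) ^+ m * (1 + m%:R * z) <= 1.
Proof.
move=> /andP[z0 z1].
have h : 0 <= (1 - z) ^+ m by rewrite exprn_ge0// subr_ge0.
rewrite (le_trans (ler_wpM2l h (bernoulli_add m z0)))// -exprMn.
have -> : (1 - z) * (1 + z) = 1 - z ^+ 2 by ring.
by rewrite exprn_ile1// ?subr_ge0 ?expr_le1// lerBlDr lerDl sqr_ge0.
Qed.

(** On [0, 1] these polynomials converge to the indicator of y > 1/2, with a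
geometric error away from 1/2; this replaces a Weierstrass approximation. *)
Definition step_poly n y := 1 - (1 - y ^+ n) ^+ (2 ^ n).

Lemma step_poly_ge0 n y : 0 <= y <= 1 -> 0 <= step_poly n y.
Proof.
move=> /andP[y0 y1]; rewrite subr_ge0 exprn_ile1 ?subr_ge0 ?exprn_ile1//.
by rewrite lerBlDr lerDl exprn_ge0.
Qed.

Lemma step_poly_le1 n y : 0 <= y <= 1 -> step_poly n y <= 1.
Proof.
move=> /andP[y0 y1].
by rewrite lerBlDr lerDl exprn_ge0// subr_ge0 exprn_ile1.
Qed.

Lemma step_poly_small n y : 0 <= y <= 1 -> step_poly n y <= (2 * y) ^+ n.
Proof.
move=> /andP[y0 y1]; rewrite /step_poly lerBlDr -lerBlDl exprMn -natrX.
by apply: bernoulli_sub; rewrite exprn_ge0//= exprn_ile1.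
Qed.

Lemma step_poly_large n y : 0 < y <= 1 -> 1 - (2 * y)^-1 ^+ n <= step_poly n y.
Proof.
move=> /andP[y0 y1]; rewrite /step_poly lerD2l lerN2.
have y2 : 0 < (2 * y) ^+ n by rewrite exprn_gt0// mulr_gt0.
have z01 : 0 <= y ^+ n <= 1 by rewrite exprn_ge0 ?exprn_ile1// ltW.
have := bernoulli_inv (2 ^ n) z01; rewrite natrX -exprMn => h.
rewrite exprVn -div1r ler_pdivlMr// (le_trans _ h)// ler_wpM2l ?lerDr//.
by rewrite exprn_ge0// subr_ge0; case/andP: z01.
Qed.

End SharpPolynomial.

Lemma le_of_geometric_error {R : realType} (s t p q : R) : 0 <= s < 1 -> 0 <= t < 1 ->
  (forall n, (1 - s ^+ n) * p <= q + t ^+ n) -> p <= q.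
Proof.
move=> /andP[s0 s1] /andP[t0 t1] h.
have cs : (fun n => (1 - s ^+ n) * p) @ \oo --> (1 - 0) * p.
  apply: cvgM; last exact: cvg_cst.
  by apply: cvgB; [exact: cvg_cst | apply: cvg_expr; rewrite ger0_norm].
have ct : (fun n => q + t ^+ n) @ \oo --> q + 0.
  by apply: cvgD; [exact: cvg_cst | apply: cvg_expr; rewrite ger0_norm].
rewrite -[p]mul1r -[X in X * p]subr0 -[q]addr0.
by apply: (ler_cvg_to cs ct); exact: nearW.
Qed.

Section Moments.
Context {d1 d2} {T1 : measurableType d1} {T2 : measurableType d2} {R : realType}.
Variables (P1 : probability T1 R) (P2 : probability T2 R).
Variables (X : T1 -> R) (Y : T2 -> R).
Hypotheses (bX : bmeas X) (bY : bmeas Y).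
Hypothesis moments : forall n, \int[P1]_x X x ^+ n = \int[P2]_y Y y ^+ n.

Lemma eq_bint_poly (p : {poly R}) : \int[P1]_x p.[X x] = \int[P2]_y p.[Y y].
Proof.
have E d (T : measurableType d) (P : probability T R) (Z : T -> R) :
    bmeas Z -> \int[P]_x p.[Z x] = \sum_(i < size p) p`_i * \int[P]_x Z x ^+ i.
  move=> bZ; transitivity (\int[P]_x \sum_(i < size p) p`_i * Z x ^+ i).
    by apply: eq_Rintegral => x _; rewrite horner_coef.
  rewrite bint_sum; last by move=> i; apply: bmeasZ; exact: bmeasX.
  by apply: eq_bigr => i _; rewrite bintZ//; exact: bmeasX.
by rewrite !E//; apply: eq_bigr => i _; rewrite moments.
Qed.

Let meas_tail {d} {T : measurableType d} (Z : T -> R) (c : R) :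
  bmeas Z -> measurable (Z @^-1` `]c, +oo[).
Proof.
by move=> [mZ _]; rewrite -[X in measurable X]setTI; apply: mZ.
Qed.

(** Centre the step polynomial at the midpoint of b and c, after an affine change
of variable that sends all values of X and Y into [0, 1]. *)
Lemma tail_le (b c : R) : b < c ->
  fine (P2 (Y @^-1` `]c, +oo[)) <= fine (P1 (X @^-1` `]b, +oo[)).
Proof.
move=> bc.
have [[_ [M1 XM]] [_ [M2 YM]]] := (bX, bY).
(* M bounds X, Y and the two thresholds; l below maps [-M, M] into [0, 1] and
   the midpoint a to 1/2 *)
pose M := 1 + `|M1| + `|M2| + `|b| + `|c|.
have M0 : 0 < M by rewrite /M -!addrA ltr_wpDr// !addr_ge0.
have XM' x : `|X x| <= M.
  by rewrite (le_trans (XM x))// (le_trans (ler_norm _))// /M; have := normr_ge0 M2;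
     have := normr_ge0 b; have := normr_ge0 c; lra.
have YM' x : `|Y x| <= M.
  by rewrite (le_trans (YM x))// (le_trans (ler_norm _))// /M; have := normr_ge0 M1;
     have := normr_ge0 b; have := normr_ge0 c; lra.
have bM : `|b| <= M.
  by rewrite /M; have := normr_ge0 M1; have := normr_ge0 M2; have := normr_ge0 c; lra.
have cM : `|c| <= M.
  by rewrite /M; have := normr_ge0 M1; have := normr_ge0 M2; have := normr_ge0 b; lra.
pose k := (4 * M)^-1.
have k0 : 0 < k by rewrite invr_gt0 mulr_gt0.
have kM : k * M = 1 / 4 by rewrite /k; field; rewrite gt_eqF.
pose a := (b + c) / 2.
pose l t := k * (t - a) + 1 / 2.
have l01 t : `|t| <= M -> 0 <= l t <= 1.
  rewrite /l /a; move: bM cM; rewrite !ler_norml => /andP[? ?] /andP[? ?] /andP[? ?].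
  by apply/andP; split; nra.
pose e := k * (c - b).
have e0 : 0 < e by rewrite mulr_gt0// subr_gt0.
have e1 : e <= 1 / 2.
  by move: bM cM; rewrite /e !ler_norml => /andP[? ?] /andP[? ?]; nra.
pose r n : {poly R} := 1 - (1 - (k *: ('X - a%:P) + (1 / 2)%:P) ^+ n) ^+ (2 ^ n).
have rE n t : (r n).[t] = step_poly n (l t).
  by rewrite /r /step_poly /l !hornerE.
have b_r d (T : measurableType d) (Z : T -> R) n : bmeas Z ->
    bmeas (fun x => step_poly n (l (Z x))).
  move=> bZ; apply: bmeasB; first exact: bmeas_cst.
  apply: bmeasX; apply: bmeasB; first exact: bmeas_cst.
  apply: bmeasX; apply: bmeasD; last exact: bmeas_cst.
  by apply: bmeasZ; apply: bmeasB => //; exact: bmeas_cst.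
apply: (@le_of_geometric_error _ (1 + e)^-1 (1 - e)).
- by rewrite invr_ge0 addr_ge0 ?(ltW e0)//= invf_lt1 ?addr_gt0// ltrDl.
- by apply/andP; split; lra.
move=> n.
have mY := meas_tail c bY; have mX := meas_tail b bX.
rewrite -(bint_indic P2 mY) -(bint_indic P1 mX) -bintZ; last exact: bmeas_indic.
apply: (@le_trans _ _ (\int[P2]_y step_poly n (l (Y y)))).
  apply: le_bint; [exact/bmeasZ/bmeas_indic | exact: b_r|] => y.
  rewrite indicE; case: (boolP (_ \in _)) => [|_]; last first.
    by rewrite mulr0 step_poly_ge0 ?l01.
  rewrite inE/= in_itv/= andbT mulr1 => cY.
  have lY : 1 + e <= 2 * l (Y y) by rewrite /l /a /e; nra.
  have lY0 : 0 < l (Y y) by lra.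
  have /andP[_ lY1] := l01 _ (YM' y).
  apply: le_trans (step_poly_large n _); last by rewrite lY0.
  rewrite lerD2l lerN2 lerXn2r ?nnegrE ?invr_ge0//; [lra|lra|].
  by rewrite lef_pV2 ?posrE//; lra.
have -> : \int[P2]_y step_poly n (l (Y y)) = \int[P1]_x step_poly n (l (X x)).
  transitivity (\int[P2]_y (r n).[Y y]); first by apply: eq_Rintegral => y _; rewrite rE.
  by rewrite -eq_bint_poly; apply: eq_Rintegral => y _; rewrite rE.
rewrite -[X in _ <= _ + X](bint_cst P1 ((1 - e) ^+ n)) -bintD; first last.
- exact: bmeas_cst.
- exact: bmeas_indic.
apply: le_bint; [exact: b_r | by apply: bmeasD; [exact: bmeas_indic|exact: bmeas_cst]|] => x.
rewrite indicE; case: (boolP (_ \in _)) => [_|].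
  by rewrite (le_trans (step_poly_le1 _ (l01 _ (XM' x))))// lerDl exprn_ge0//; lra.
rewrite notin_setE/= in_itv/= andbT => /negP; rewrite -leNgt => Xb.
have /andP[lX0 lX1] := l01 _ (XM' x).
rewrite add0r (le_trans (step_poly_small n _)) ?lX0//.
rewrite lerXn2r ?nnegrE//; [by rewrite mulr_ge0|lra|].
by rewrite /l /a /e; nra.
Qed.

(** By [tail_le] at thresholds decreasing to b and continuity from below. *)
Lemma tail_le_eq (b : R) : (P2 (Y @^-1` `]b, +oo[) <= P1 (X @^-1` `]b, +oo[))%E.
Proof.
have YE : Y @^-1` `]b, +oo[ = \bigcup_n (Y @^-1` `](b + n.+1%:R^-1)%R, +oo[).
  apply/seteqP; split => y /=.
    rewrite in_itv/= andbT => /ltr_add_invr[n bn].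
    by exists n => //=; rewrite in_itv/= bn.
  move=> [n _] /=; rewrite !in_itv/= !andbT; apply: le_lt_trans.
  by rewrite lerDl invr_ge0.
have mY n : measurable (Y @^-1` `](b + n.+1%:R^-1)%R, +oo[) by exact: meas_tail.
have ndY : nondecreasing_seq (fun n => Y @^-1` `](b + n.+1%:R^-1)%R, +oo[).
  move=> m n mn; apply/subsetPset => y /=; rewrite !in_itv/= !andbT.
  by apply: le_lt_trans; rewrite lerD2l lef_pV2 ?posrE// ler_nat.
have := nondecreasing_cvg_mu (mu := P2) mY (bigcupT_measurable _ mY) ndY.
rewrite -YE => cY.
have := cY; move/cvg_lim => <- //; apply: lime_le.
  by apply/cvg_ex; eexists; exact: cY.
apply: nearW => n /=.
rewrite -(fineK (fin_num_measure P2 _ (mY n))).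
rewrite -(fineK (fin_num_measure P1 _ (meas_tail b bX))) lee_fin.
by apply: tail_le; rewrite ltrDl invr_gt0.
Qed.

End Moments.

Lemma eq_law_of_moments {d1 d2} {T1 : measurableType d1} {T2 : measurableType d2}
    {R : realType} (P1 : probability T1 R) (P2 : probability T2 R)
    (X : T1 -> R) (Y : T2 -> R) : bmeas X -> bmeas Y ->
  (forall n, \int[P1]_x X x ^+ n = \int[P2]_y Y y ^+ n) ->
  forall A : set R, measurable A -> P1 (X @^-1` A) = P2 (Y @^-1` A).
Proof.
move=> bX bY moments A mA.
have mX B : measurable B -> measurable (X @^-1` B).
  by move=> mB; rewrite -[X in measurable X]setTI; case: bX => mX _; exact: mX.
have mY B : measurable B -> measurable (Y @^-1` B).
  by move=> mB; rewrite -[X in measurable X]setTI; case: bY => mY _; exact: mY.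
have mE : @measurable _ (measurableTypeR R) = <<s @RGenOInfty.G R >>.
  exact: RGenOInfty.measurableE.
move: (mA : @measurable _ (measurableTypeR R) A); rewrite mE; move: A {mA}.
apply: (dynkin_induction (T := measurableTypeR R) (G := @RGenOInfty.G R)
  (P := fun A => P1 (X @^-1` A) = P2 (Y @^-1` A))) => //.
- move=> _ _ [a ->] [b ->]; exists (Num.max a b).
  apply/seteqP; split => t /=; rewrite !in_itv/= !andbT gt_max.
    by move=> [-> ->].
  by move=> /andP[].
- by rewrite !preimage_setT !probability_setT.
- move=> _ [b ->]; apply/eqP; rewrite eq_le; apply/andP; split.
    by apply: tail_le_eq => // n; rewrite moments.
  exact: tail_le_eq.
- move=> S mS SE.
  have cX := @probability_setC _ _ _ P1 _ (mX S mS).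
  have cY := @probability_setC _ _ _ P2 _ (mY S mS).
  by apply: (etrans cX); rewrite SE; exact: esym cY.
- move=> F mF tF FE; rewrite !preimage_bigcup.
  rewrite (measure_bigcup P1) ?(measure_bigcup P2).
  + by apply: eq_eseriesr => n _; exact: FE.
  + by move=> n _; exact: mY (mF n).
  + apply/trivIsetP => i j _ _ ij; rewrite -preimage_setI.
    by move/trivIsetP : tF => /(_ _ _ _ _ ij) ->//; rewrite preimage_set0.
  + by move=> n _; exact: mX (mF n).
  + apply/trivIsetP => i j _ _ ij; rewrite -preimage_setI.
    by move/trivIsetP : tF => /(_ _ _ _ _ ij) ->//; rewrite preimage_set0.
Qed.

(** * Densities of graphs with pendant edges *)
Section Densities.
Context {R : realType}.
Local Notation Rm := (measurableTypeR R).
Local Notation mu := (@leb01 R).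

(** A kernel on the whole plane.  Only its values on the unit square matter to
leb01; a kernel in the sense of [is_kernel] becomes total when it is extended by
zero. *)
Definition total_kernel (V : R -> R -> R) : Prop :=
  bmeas (fun z : Rm * Rm => V z.1 z.2) /\ forall x y, V x y = V y x.

Definition degree (V : R -> R -> R) (x : R) : R := \int[mu]_y V x y.

Lemma bmeas_degree V : total_kernel V -> bmeas (degree V : Rm -> R).
Proof. by move=> [bV _]; exact: (bmeas_int2 mu mu bV). Qed.

(** Vertices are natural numbers, read as positions in the tuple t, and a graph is
the list s of its edges; plain sequences in place of tuples keep the index
shifts below free of dependent types. *)
Definition edge_prod (V : R -> R -> R) (s : seq (nat * nat)) (t : seq R) : R :=
  \prod_(e <- s) V t`_e.1 t`_e.2.

(** The integrand of the graph s with one pendant edge attached at each vertex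
listed in p, the pendant vertices being already integrated out. *)
Definition monomial V (s : seq (nat * nat)) (p : seq nat) (t : seq R) : R :=
  edge_prod V s t * \prod_(i <- p) degree V t`_i.

Lemma measurable_coord n i : measurable_fun setT (fun t : n.-tuple Rm => t`_i : Rm).
Proof.
have [ni|ni] := leqP n i.
  rewrite (_ : (fun t => _) = fun=> 0); first exact: measurable_cst.
  by apply/funext => t; rewrite nth_default// size_tuple.
rewrite (_ : (fun t => _) = (fun t : n.-tuple Rm => tnth t (Ordinal ni))).
  exact: measurable_tnth.
by apply/funext => t; rewrite (tnth_nth 0).
Qed.

Lemma bmeas_coord2 n (f : Rm * Rm -> R) i j : bmeas f ->
  bmeas (fun t : n.-tuple Rm => f (t`_i, t`_j)).
Proof.
move=> bf; apply: (bmeas_comp bf).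
by apply: measurable_fun_pair; exact: measurable_coord.
Qed.

Lemma bmeas_coord n (f : Rm -> R) i : bmeas f ->
  bmeas (fun t : n.-tuple Rm => f t`_i).
Proof. by move=> bf; apply: (bmeas_comp bf); exact: measurable_coord. Qed.

Lemma bmeas_edge_prod V s n : total_kernel V ->
  bmeas (fun t : n.-tuple Rm => edge_prod V s t).
Proof.
by move=> [bV _]; apply: bmeas_prod => e; exact: (bmeas_coord2 _ e.1 e.2 bV).
Qed.

Lemma bmeas_monomial V s p n : total_kernel V ->
  bmeas (fun t : n.-tuple Rm => monomial V s p t).
Proof.
move=> kV; apply: bmeasM; first exact: bmeas_edge_prod.
by apply: bmeas_prod => i; apply: bmeas_coord; exact: bmeas_degree.
Qed.

(** Fubini for the recursive definition of leb01n: coordinate 0 is the innermost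
variable. *)
Lemma bint_cons n (f : seq R -> R) : bmeas (fun t : n.+1.-tuple Rm => f t) ->
  \int[leb01n R n.+1]_t f t = \int[leb01n R n]_t \int[mu]_x f (x :: t).
Proof.
move=> bf; have bg := bmeas_comp bf (@measurable_tcons R n).
rewrite -(bint_prod21 mu (leb01n R n) bg); congr fine.
have mf : measurable_fun setT (EFin \o (fun t : n.+1.-tuple Rm => f t)).
  by apply/measurable_EFinP; case: bf.
have intg := bmeas_integrable (mu \x leb01n R n)%E bg.
have := integral_pushforward (@measurable_tcons R n) mf (D := setT)
  (mu := (mu \x leb01n R n)%E).
by rewrite preimage_setT; apply.
Qed.

Lemma bmeas_cons n (f : seq R -> R) : bmeas (fun t : n.+1.-tuple Rm => f t) ->
  bmeas (fun t : n.-tuple Rm => \int[mu]_x f (x :: t)).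
Proof.
move=> bf; have bg := bmeas_comp bf (@measurable_tcons R n).
exact: (bmeas_int1 mu (leb01n R n) bg).
Qed.

Lemma bint_nil (f : seq R -> R) : bmeas (fun t : 0.-tuple Rm => f t) ->
  \int[leb01n R 0]_t f t = f [::].
Proof.
move=> [mf _]; rewrite /Rintegral/= integral_dirac//.
  by rewrite diracT mul1e.
exact/measurable_EFinP.
Qed.

Definition valid_edges n (s : seq (nat * nat)) : bool :=
  uniq s && all (fun e => (e.1 < e.2 < n)%N) s.

Definition same_densities N (U V : R -> R -> R) : Prop :=
  forall n s, (n <= N)%N -> valid_edges n s ->
    \int[leb01n R n]_t edge_prod U s t = \int[leb01n R n]_t edge_prod V s t.

Definition shift_edge (e : nat * nat) := (e.1.+1, e.2.+1).

(** A degree factor at vertex i is the integral over a new vertex, joined to i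
only.  The new vertex comes first in the tuple, so all other indices shift. *)
Lemma monomial_pendant V s i p n : total_kernel V ->
  \int[leb01n R n]_t monomial V s (i :: p) t =
  \int[leb01n R n.+1]_t
     monomial V ((0, i.+1)%N :: map shift_edge s) (map S p) t.
Proof.
move=> kV; rewrite bint_cons; last exact: bmeas_monomial.
apply: eq_Rintegral => t _.
transitivity (\int[mu]_x (monomial V s p t * V t`_i x)).
  rewrite bintZ; last first.
    case: kV => bV _; exact: (bmeas_section1 bV t`_i).
  by rewrite /monomial big_cons /degree; ring.
apply: eq_Rintegral => x _.
rewrite /monomial /edge_prod big_cons !big_map (proj2 kV t`_i x) /=; ring.
Qed.

Lemma same_monomial_densities N U V : total_kernel U -> total_kernel V ->
  same_densities N U V ->
  forall p n s, (n + size p <= N)%N -> valid_edges n s ->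
    all (fun i => i < n)%N p ->
    \int[leb01n R n]_t monomial U s p t = \int[leb01n R n]_t monomial V s p t.
Proof.
move=> kU kV UV p; move: {2}(size p) (erefl (size p)) => m.
elim: m p => [|m IHm] [|i p]//= => [_|[pm]] n s nN vs np.
  have E W : \int[leb01n R n]_t monomial W s [::] t =
             \int[leb01n R n]_t edge_prod W s t.
    by apply: eq_Rintegral => t _; rewrite /monomial big_nil mulr1.
  by rewrite !E UV// -(addn0 n).
rewrite !monomial_pendant//; apply: IHm.
- by rewrite size_map.
- by rewrite size_map addSnnS.
- move: vs => /andP[us alls]; move: np => /andP[ni np]; apply/andP; split.
    rewrite /= map_inj_uniq ?us ?andbT; last by move=> [a b] [c d'] [-> ->].
    by apply/mapP => -[e _ []].
  rewrite /= ltnS ni/= all_map; apply: sub_all alls => e /=.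
  by rewrite !ltnS.
- by move: np => /andP[_ np]; rewrite all_map; apply: sub_all np.
Qed.

End Densities.

(** * The forcing family *)
Section Family.
Context {R : realType}.
Local Notation Rm := (measurableTypeR R).
Local Notation mu := (@leb01 R).

Definition list_adj n (s : seq (nat * nat)) : rel 'I_n :=
  fun a b => (a != b) && (((a : nat, b : nat) \in s) || ((b : nat, a : nat) \in s)).

Lemma list_adj_sym n s : symmetric (@list_adj n s).
Proof. by move=> a b; rewrite /list_adj eq_sym orbC. Qed.

Lemma list_adj_irrefl n s : irreflexive (@list_adj n s).
Proof. by move=> a; rewrite /list_adj eqxx. Qed.

Definition list_graph n s := SGraph (@list_adj_sym n s) (@list_adj_irrefl n s).

Lemma measurable_cube n : measurable (cube n : set (n.-tuple Rm)).
Proof.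
rewrite (_ : cube n = \bigcap_i ((@tnth n R ^~ i) @^-1` @unitI R)); last first.
  by apply/seteqP; split=> t /= H i => [_|]; exact: H.
apply: fin_bigcap_measurable => // i _.
rewrite -[X in measurable X]setTI; apply: (@measurable_tnth _ Rm) => //.
exact: measurable_unitI.
Qed.

Lemma leb01n_cube n : leb01n R n (cube n) = 1%E.
Proof.
rewrite (leb01n_box (A := fun=> unitI)); last by move=> i; exact: measurable_unitI.
rewrite big1// => i _; rewrite /leb01 /mrestr setIid /unitI.
by rewrite lebesgue_measure_itv/= lte01 sube0.
Qed.

Lemma bint_cube n (f g : n.-tuple Rm -> R) : bmeas g ->
  (forall t, cube n t -> f t = g t) ->
  \int[leb01n R n]_(t in cube n) f t = \int[leb01n R n]_t g t.
Proof.
move=> bg fg; have mC := @measurable_cube n.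
transitivity (\int[leb01n R n]_(t in cube n) g t).
  by apply: eq_Rintegral => t /set_mem /fg.
rewrite Rintegral_mkcond; have -> : g \_ (cube n) = (fun t => \1_(cube n) t * g t).
  apply/funext => t; rewrite /patch indicE; case: ifPn => _; first by rewrite mul1r.
  by rewrite mul0r.
apply: bint_ae_eq => //; first by apply: bmeasM => //; exact: bmeas_indic.
exists (~` cube n); split; first exact: measurableC.
  have -> : leb01n R n (~` cube n) = (1 - leb01n R n (cube n))%E.
    exact: probability_setC.
  by rewrite leb01n_cube subee.
move=> t /= nt Ct; apply: nt; rewrite indicE mem_set//= mul1r.
by [].
Qed.

(** The product over ordered adjacent pairs in [hom_density] meets every edge of
a valid list once. *)
Lemma prod_list_graph n s (G : nat * nat -> R) : valid_edges n s ->
  \prod_(e : 'I_n * 'I_n | list_adj s e.1 e.2 && (e.1 < e.2)%N)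
    G (e.1 : nat, e.2 : nat) = \prod_(e <- s) G e.
Proof.
move=> /andP[us /allP alls].
pose h (e : 'I_n * 'I_n) := (e.1 : nat, e.2 : nat).
transitivity (\prod_(e <- map h
    [seq e : 'I_n * 'I_n <- index_enum _ | list_adj s e.1 e.2 && (e.1 < e.2)%N]) G e).
  by rewrite big_map big_filter.
apply: perm_big; apply: uniq_perm => //.
  rewrite map_inj_uniq; first by rewrite filter_uniq// index_enum_uniq.
  by move=> [a b] [c d] [/val_inj -> /val_inj ->].
move=> [a b]; apply/mapP/idP => [[[i j]] | abs].
  rewrite mem_filter /list_adj /= => /andP[/andP[/andP[_ /orP[ijs|jis]] ij] _] [-> ->] //.
  by have := alls _ jis => /= /andP[]; rewrite ltnNge (ltnW ij).
have /= /andP[ab bn] := alls _ abs.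
exists (Ordinal (ltn_trans ab bn), Ordinal bn) => //.
rewrite mem_filter /list_adj /= abs ab mem_index_enum !andbT/=.
by rewrite -val_eqE /= neq_ltn ab.
Qed.

Lemma hom_density_list n s (U V : R -> R -> R) : valid_edges n s ->
  total_kernel V -> (forall x y, unitI x -> unitI y -> U x y = V x y) ->
  hom_density (list_graph n s) U = \int[leb01n R n]_t edge_prod V s t.
Proof.
move=> vs kV UV; rewrite /hom_density /=.
transitivity (\int[leb01n R #|'I_n|]_(t in cube #|'I_n|) edge_prod U s t).
  apply: eq_Rintegral => t _; rewrite /edge_prod.
  rewrite -(prod_list_graph (fun e => U t`_e.1 t`_e.2) vs).
  by apply: eq_big => [e|e _]; rewrite ?(tnth_nth 0) !enum_rank_ord.
rewrite (bint_cube (g := fun t => edge_prod V s t)); first by rewrite card_ord.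
  exact: bmeas_edge_prod.
move=> t Ct; rewrite /edge_prod; apply: eq_big_seq => e es; apply: UV.
all: have /andP[_ /allP/(_ _ es) /andP[e12 e2]] := vs.
- have e1 : (e.1 < #|'I_n|)%N by rewrite card_ord (ltn_trans e12).
  by have := Ct (Ordinal e1); rewrite (tnth_nth 0).
- have e2' : (e.2 < #|'I_n|)%N by rewrite card_ord.
  by have := Ct (Ordinal e2'); rewrite (tnth_nth 0).
Qed.

(** All graphs on at most N labelled vertices: the second component lists edges
on the vertex set of size N, and those outside the first n vertices are
ignored. *)
Definition family_index N : finType := ('I_N.+1 * {set 'I_N * 'I_N})%type.

Definition family_graph N (i : family_index N) : sgraph :=
  list_graph i.1 [seq (e.1 : nat, e.2 : nat) | e : 'I_N * 'I_N <- enum i.2].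

Definition graph_family N (i : 'I_#|family_index N|) : sgraph := family_graph (enum_val i).

Lemma list_graph_in_family N n s : (n <= N)%N -> valid_edges n s ->
  exists i, @graph_family N i = list_graph n s.
Proof.
move=> nN vs; have /andP[_ /allP alls] := vs.
have nN1 : (n < N.+1)%N by [].
pose S := [set e : 'I_N * 'I_N | (e.1 : nat, e.2 : nat) \in s]%SET.
exists (enum_rank ((Ordinal nN1, S) : family_index N)).
rewrite /graph_family enum_rankK /family_graph /=.
set s' := map _ _.
have ss' : s' =i s.
  move=> [a b]; apply/mapP/idP => [[e] | abs].
    by rewrite mem_enum inE => + [-> ->].
  have /= /andP[ab bn] := alls _ abs.
  have bN := leq_trans bn nN.
  exists (Ordinal (ltn_trans ab bN), Ordinal bN) => //.
  by rewrite mem_enum inE.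
have E : @list_adj n s' = @list_adj n s.
  by apply/funext => a; apply/funext => b; rewrite /list_adj !ss'.
rewrite /list_graph; move: (@list_adj_sym n s') (@list_adj_irrefl n s').
by rewrite E => a b; congr SGraph; exact: Prop_irrelevance.
Qed.

Lemma same_densities_of_family N (U U' V : R -> R -> R) :
  total_kernel U' -> (forall x y, unitI x -> unitI y -> U x y = U' x y) ->
  total_kernel V ->
  (forall i, hom_density (@graph_family N i) U = hom_density (graph_family i) V) ->
  same_densities N U' V.
Proof.
move=> kU UU' kV famE n s nN vs.
have [i iE] := list_graph_in_family nN vs.
rewrite -(hom_density_list vs kU UU') -(hom_density_list vs kV (fun _ _ _ _ => erefl)).
by rewrite -iE famE.
Qed.

End Family.

(** * Polynomial expressions whose integrals are forced *)
Section GraphPolynomials.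
Context {R : realType}.
Local Notation Rm := (measurableTypeR R).
Local Notation mu := (@leb01 R).
Implicit Types (V : R -> R -> R) (S : seq (nat * nat)).

(** Coefficient, edge list and pendant list. *)
Definition term : Type := R * seq (nat * nat) * seq nat.

Definition term_in n S m (l : term) : bool :=
  [&& subseq l.1.2 S, (size l.2 <= m)%N & all (fun i => i < n)%N l.2].

Definition eval_term V (t : seq R) (l : term) : R := l.1.1 * monomial V l.1.2 l.2 t.

(** f is a linear combination of monomials with n core vertices, edges taken
among S without repetition, and at most m pendant edges.  Membership of the
edge lists in S is what excludes multiple edges in the products below. *)
Definition graph_poly n S m (f : (R -> R -> R) -> seq R -> R) : Prop :=
  exists L : seq term, all (term_in n S m) L /\
    forall V t, f V t = \sum_(l <- L) eval_term V t l.

Lemma graph_poly_cst n S m (c : R) : graph_poly n S m (fun _ _ => c).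
Proof.
exists [:: (c, [::], [::])]; split; first by rewrite /= /term_in/= sub0seq.
by move=> V t; rewrite big_seq1 /eval_term /monomial /edge_prod !big_nil !mulr1.
Qed.

Lemma graph_poly_degree n S m i : (i < n)%N -> (0 < m)%N ->
  graph_poly n S m (fun V t => degree V t`_i).
Proof.
move=> ni m0; exists [:: (1, [::], [:: i])]; split.
  by rewrite /= /term_in/= sub0seq m0 ni.
move=> V t; rewrite big_seq1 /eval_term /monomial /edge_prod/= big_nil big_seq1.
by rewrite !mul1r.
Qed.

Lemma graph_poly_edge n m i j :
  graph_poly n [:: (i, j)] m (fun V t => V t`_i t`_j).
Proof.
exists [:: (1, [:: (i, j)], [::])]; split.
  by rewrite /= /term_in/= eqxx.
move=> V t; rewrite big_seq1 /eval_term /monomial /edge_prod/= big_nil big_seq1.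
by rewrite mul1r mulr1.
Qed.

Lemma graph_polyD n S m f g : graph_poly n S m f -> graph_poly n S m g ->
  graph_poly n S m (fun V t => f V t + g V t).
Proof.
move=> [L [aL Lf]] [K [aK Kg]]; exists (L ++ K); split.
  by rewrite all_cat aL aK.
by move=> V t; rewrite big_cat /= Lf Kg.
Qed.

(** The edge supports are concatenated, so a product of expressions with disjoint
supports stays free of multiple edges. *)
Lemma graph_polyM n S S' m m' f g : graph_poly n S m f -> graph_poly n S' m' g ->
  graph_poly n (S ++ S') (m + m') (fun V t => f V t * g V t).
Proof.
move=> [L [aL Lf]] [K [aK Kg]].
exists [seq ((l.1.1 * k.1.1, l.1.2 ++ k.1.2, l.2 ++ k.2) : term) | l <- L, k <- K].
split.
  apply/all_allpairsP => -[[c s] p] [[c' s'] p'] /(allP aL) /and3P[/= ss pm np].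
  move=> /(allP aK) /and3P[/= ss' pm' np']; rewrite /term_in /=.
  by rewrite cat_subseq// size_cat leq_add// all_cat np np'.
move=> V t; rewrite big_allpairs_dep Lf Kg big_distrl /=; apply: eq_bigr => l _.
rewrite big_distrr /=; apply: eq_bigr => k _.
by rewrite /eval_term /monomial /edge_prod/= !big_cat/=; ring.
Qed.

Lemma graph_poly_weaken n S S' m m' f : subseq S S' -> (m <= m')%N ->
  graph_poly n S m f -> graph_poly n S' m' f.
Proof.
move=> SS mm [L [aL Lf]]; exists L; split => //.
apply: sub_all aL => l /and3P[sS pm np]; apply/and3P; split => //.
  exact: subseq_trans sS SS.
exact: leq_trans pm mm.
Qed.

Lemma graph_polyZ n S m (c : R) f : graph_poly n S m f ->
  graph_poly n S m (fun V t => c * f V t).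
Proof. exact: (graph_polyM (graph_poly_cst n [::] 0 c)). Qed.

Lemma graph_polyB n S m f g : graph_poly n S m f -> graph_poly n S m g ->
  graph_poly n S m (fun V t => f V t - g V t).
Proof.
move=> pf pg; have [L [aL E]] := graph_polyD pf (graph_polyZ (-1) pg).
by exists L; split => // V t; rewrite -E mulN1r.
Qed.

(** The coefficients are arbitrary and may depend on lambda; the graphs involved
do not. *)
Lemma bint_graph_poly n S m f N U V : total_kernel U -> total_kernel V ->
  same_densities N U V ->
  graph_poly n S m f -> valid_edges n S -> (n + m <= N)%N ->
  \int[leb01n R n]_t f U t = \int[leb01n R n]_t f V t.
Proof.
move=> kU kV UV [L [/allP aL E]] /andP[uS /allP aS] nmN.
have sumE W : total_kernel W -> \int[leb01n R n]_t f W t =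
    \sum_(l <- L) l.1.1 * \int[leb01n R n]_t monomial W l.1.2 l.2 t.
  move=> kW; transitivity (\int[leb01n R n]_t \sum_(l <- L) eval_term W t l).
    by apply: eq_Rintegral => t _; rewrite E.
  rewrite bint_sum; last by move=> l; apply: bmeasZ; exact: bmeas_monomial.
  by apply: eq_bigr => l _; rewrite bintZ//; exact: bmeas_monomial.
rewrite (sumE U kU) (sumE V kV); apply: eq_big_seq => l /aL /and3P[sS pm np]; congr (_ * _).
apply: (same_monomial_densities kU kV UV) => //.
  by rewrite (leq_trans _ nmN)// leq_add2l.
rewrite /valid_edges (subseq_uniq sS uS)/=; apply/allP => e es.
exact: aS (mem_subseq sS es).
Qed.

End GraphPolynomials.

(** * The identities satisfied by the Poisson-type kernel, and why they are forced *)
Section ForcingPolynomials.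
Context {R : realType}.
Local Notation Rm := (measurableTypeR R).
Local Notation mu := (@leb01 R).
Implicit Types (V : R -> R -> R) (lam : R).

(** For the target kernel this is cos (pi x). *)
Definition hdeg V (x : R) : R := 8 * degree V x - 4.

(** The denominator of the symmetrised Poisson kernel: for a = cos s and b = cos t
it is the product of 1 - 2 lambda cos th + lambda^2 at th = s + t and
th = s - t. *)
Definition poisson_quad lam (a b : R) : R :=
  (1 - lam ^+ 2) ^+ 2 - 4 * lam * (1 + lam ^+ 2) * (a * b)
  + 4 * lam ^+ 2 * (a * a + b * b).

(** Twice the kernel value w, with its terms of order 0 and 1 replaced so that on
the target kernel the sum is
1 + 2 sum_(n >= 1) lambda^n cos (n s) cos (n t), for a = cos s and b = cos t. *)
Definition full_kernel lam (w a b : R) : R :=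
  2 * (w - 1 / 2 - (a + b) / 8 - a * b / 16) + 1 + 2 * lam * (a * b).

(** The closed form of the Poisson kernel after clearing its denominator. *)
Definition defect lam V (x y : R) : R :=
  full_kernel lam (V x y) (hdeg V x) (hdeg V y) * poisson_quad lam (hdeg V x) (hdeg V y)
  - (1 - lam ^+ 2) * (1 + lam ^+ 2 - 2 * lam * (hdeg V x * hdeg V y)).

(** Integrates in y to 0 exactly when U h = 1/16 + h/32, where h = hdeg U. *)
Definition eigen_defect V (x y : R) : R :=
  V y x * hdeg V y - 1 / 16 - hdeg V x / 32.

Lemma graph_poly_hdeg n S m i : (i < n)%N -> (0 < m)%N ->
  graph_poly n S m (fun V t => hdeg V t`_i).
Proof.
move=> ni m0; apply: graph_polyB; last exact: graph_poly_cst.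
by apply: graph_polyZ; exact: graph_poly_degree.
Qed.

Lemma graph_poly_hdegM n S i j : (i < n)%N -> (j < n)%N ->
  graph_poly n S 2 (fun V t => hdeg V t`_i * hdeg V t`_j).
Proof.
move=> ni nj; exact: (graph_polyM (graph_poly_hdeg [::] ni (leqnn 1))
  (graph_poly_hdeg S nj (leqnn 1))).
Qed.

Lemma graph_poly_defect lam n i j : (i < n)%N -> (j < n)%N ->
  graph_poly n [:: (i, j)] 4 (fun V t => defect lam V t`_i t`_j).
Proof.
move=> ni nj; apply: graph_polyB.
  apply: (graph_polyM (S := [:: (i, j)]) (S' := [::]) (m := 2) (m' := 2)).
    apply: graph_polyD; last by apply: graph_polyZ; exact: graph_poly_hdegM.
    apply: graph_polyD; last exact: graph_poly_cst.
    apply: graph_polyZ; apply: graph_polyB.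
      apply: graph_polyB.
        by apply: graph_polyB; [exact: graph_poly_edge | exact: graph_poly_cst].
      have [L [aL E]] := graph_polyZ 8^-1 (graph_polyD
        (graph_poly_hdeg [:: (i, j)] ni (ltn0Sn 1))
        (graph_poly_hdeg [:: (i, j)] nj (ltn0Sn 1))).
      by exists L; split => // V t; rewrite -E mulrC.
    have [L [aL E]] := graph_polyZ 16^-1 (graph_poly_hdegM [:: (i, j)] ni nj).
    by exists L; split => // V t; rewrite -E mulrC.
  apply: graph_polyD; last first.
    by apply: graph_polyZ; apply: graph_polyD; exact: graph_poly_hdegM.
  apply: graph_polyB; first exact: graph_poly_cst.
  by apply: graph_polyZ; exact: graph_poly_hdegM.
apply: graph_polyZ; apply: graph_polyB; first exact: graph_poly_cst.
apply: graph_polyZ.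
apply: (graph_poly_weaken (S := [::]) (m := 2)) => //; exact: graph_poly_hdegM.
Qed.

Lemma graph_poly_eigen_defect n i j : (i < n)%N -> (j < n)%N ->
  graph_poly n [:: (j, i)] 1 (fun V t => eigen_defect V t`_i t`_j).
Proof.
move=> ni nj; apply: graph_polyB.
  apply: graph_polyB; last exact: graph_poly_cst.
  exact: (graph_polyM (graph_poly_edge n 0 j i) (graph_poly_hdeg [::] nj (leqnn 1))).
have [L [aL E]] := graph_polyZ 32^-1 (graph_poly_hdeg [:: (j, i)] ni (leqnn 1)).
by exists L; split => // V t; rewrite -E mulrC.
Qed.

Lemma bint1E (g : R -> R) : bmeas (g : Rm -> R) ->
  \int[leb01n R 1]_t g t`_0 = \int[mu]_x g x.
Proof.
move=> bg; rewrite (bint_cons (f := fun t => g t`_0)); last exact: bmeas_coord.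
rewrite (bint_nil (f := fun t => \int[mu]_x g (x :: t)`_0))//=.
exact: bmeas_cst.
Qed.

Fixpoint iterated_int n (f : seq R -> R) : R :=
  if n is n'.+1 then iterated_int n' (fun t => \int[mu]_x f (x :: t)) else f [::].

Lemma bint_iterated n (f : seq R -> R) : bmeas (fun t : n.-tuple Rm => f t) ->
  \int[leb01n R n]_t f t = iterated_int n f.
Proof.
elim: n f => [|n IHn] f bf; first exact: bint_nil.
rewrite (bint_cons bf) /= -IHn//; exact: (bmeas_cons bf).
Qed.

Lemma bmeas_hdeg V : total_kernel V -> bmeas (hdeg V : Rm -> R).
Proof.
move=> kV; apply: bmeasB; last exact: bmeas_cst.
by apply: bmeasZ; exact: bmeas_degree.
Qed.

Lemma bmeas_full_kernel lam V : total_kernel V ->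
  bmeas (fun z : Rm * Rm => full_kernel lam (V z.1 z.2) (hdeg V z.1) (hdeg V z.2)).
Proof.
move=> kV; have bh := bmeas_hdeg kV.
have b1 : bmeas (fun z : Rm * Rm => hdeg V z.1) by exact: (bmeas_comp bh).
have b2 : bmeas (fun z : Rm * Rm => hdeg V z.2) by exact: (bmeas_comp bh).
have b12 : bmeas (fun z : Rm * Rm => hdeg V z.1 * hdeg V z.2) by exact: bmeasM.
have bc c : bmeas (fun _ : Rm * Rm => c : R) := bmeas_cst c.
have [bV _] := kV.
apply: bmeasD; last exact: bmeasZ.
apply: bmeasD => //; apply: bmeasZ.
apply: bmeasB; last exact: bmeasM.
apply: bmeasB; first exact: bmeasB.
by apply: bmeasM => //; exact: bmeasD.
Qed.

Lemma bmeas_defect lam V : total_kernel V ->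
  bmeas (fun z : Rm * Rm => defect lam V z.1 z.2).
Proof.
move=> kV; have bh := bmeas_hdeg kV.
have b1 : bmeas (fun z : Rm * Rm => hdeg V z.1) by exact: (bmeas_comp bh).
have b2 : bmeas (fun z : Rm * Rm => hdeg V z.2) by exact: (bmeas_comp bh).
have b12 : bmeas (fun z : Rm * Rm => hdeg V z.1 * hdeg V z.2) by exact: bmeasM.
have bc c : bmeas (fun _ : Rm * Rm => c : R) := bmeas_cst c.
apply: bmeasB; last by apply: bmeasZ; apply: bmeasB => //; exact: bmeasZ.
apply: bmeasM; first exact: bmeas_full_kernel.
apply: bmeasD; last by apply: bmeasZ; apply: bmeasD; exact: bmeasM.
by apply: bmeasB => //; exact: bmeasZ.
Qed.

Lemma bmeas_eigen_defect V : total_kernel V ->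
  bmeas (fun z : Rm * Rm => eigen_defect V z.1 z.2).
Proof.
move=> kV.
have bh := bmeas_hdeg kV.
have b1 : bmeas (fun z : Rm * Rm => hdeg V z.1) by exact: (bmeas_comp bh).
have b2 : bmeas (fun z : Rm * Rm => hdeg V z.2) by exact: (bmeas_comp bh).
have bc c : bmeas (fun _ : Rm * Rm => c : R) := bmeas_cst c.
have [bV sV] := kV.
apply: bmeasB; last by apply: bmeasM.
apply: bmeasB => //; apply: bmeasM => //.
rewrite (_ : (fun z => _) = (fun z : Rm * Rm => V z.1 z.2))//.
by apply/funext => z; rewrite sV.
Qed.

(** A cherry: vertices 0 and 1 are joined to vertex 2 only. *)
Lemma eigen_density V : total_kernel V ->
  \int[leb01n R 3]_t (eigen_defect V t`_2 t`_0 * eigen_defect V t`_2 t`_1) =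
  \int[mu]_x (\int[mu]_y eigen_defect V x y) ^+ 2.
Proof.
move=> kV.
pose g (t : seq R) := eigen_defect V t`_2 t`_0 * eigen_defect V t`_2 t`_1.
have be := bmeas_eigen_defect kV.
have bg : bmeas (fun t : 3.-tuple Rm => g t).
  by apply: bmeasM; [exact: (bmeas_coord2 _ 2 0 be) | exact: (bmeas_coord2 _ 2 1 be)].
rewrite (bint_iterated bg) /=.
apply: eq_Rintegral => x _; rewrite /g /=.
have bx : bmeas (fun y : Rm => eigen_defect V x y) := bmeas_section1 be x.
exact: bint_square.
Qed.

(** The four-cycle with opposite vertices 0, 1 and 2, 3: the two innermost
integrals factor into the square of a codegree. *)
Lemma cycle_density lam V : total_kernel V ->
  \int[leb01n R 4]_t (defect lam V t`_0 t`_2 * defect lam V t`_0 t`_3 *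
     (defect lam V t`_1 t`_2 * defect lam V t`_1 t`_3)) =
  \int[mu]_v \int[mu]_u (\int[mu]_z (defect lam V z u * defect lam V z v)) ^+ 2.
Proof.
move=> kV.
pose g (t : seq R) := defect lam V t`_0 t`_2 * defect lam V t`_0 t`_3 *
     (defect lam V t`_1 t`_2 * defect lam V t`_1 t`_3).
have be := bmeas_defect lam kV.
have bg : bmeas (fun t : 4.-tuple Rm => g t).
  by apply: bmeasM; apply: bmeasM;
    [exact: (bmeas_coord2 _ 0 2 be) | exact: (bmeas_coord2 _ 0 3 be)
    | exact: (bmeas_coord2 _ 1 2 be) | exact: (bmeas_coord2 _ 1 3 be)].
rewrite (bint_iterated bg) /=.
apply: eq_Rintegral => v _; apply: eq_Rintegral => u _; rewrite /g /=.
have bz : bmeas (fun z : Rm => defect lam V z u * defect lam V z v).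
  by apply: bmeasM; exact: (bmeas_section2 be).
exact: bint_square.
Qed.


Section Forcing.
(* The largest graphs occur in [forced_defect]: the four core vertices of a
   cycle and at most four pendant edges for each of its four factors. *)
Variables U V : R -> R -> R.
Hypotheses (kU : total_kernel U) (kV : total_kernel V).
Hypothesis UV : same_densities 20 U V.

Lemma forced_mean : \int[mu]_x hdeg U x = \int[mu]_x hdeg V x.
Proof.
have := bint_graph_poly kU kV UV (graph_poly_hdeg (n := 1) [::] (ltn0Sn 0) (leqnn 1)).
by rewrite !(bint1E (g := hdeg _)); [apply | exact: bmeas_hdeg..].
Qed.

Lemma forced_square :
  \int[mu]_x (hdeg U x * hdeg U x) = \int[mu]_x (hdeg V x * hdeg V x).
Proof.
have := bint_graph_poly kU kV UV
  (graph_poly_hdegM (n := 1) [::] (ltn0Sn 0) (ltn0Sn 0)).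
by rewrite !(bint1E (g := fun x => hdeg _ x * hdeg _ x));
  [apply | apply: bmeasM; exact: bmeas_hdeg..].
Qed.

Lemma forced_eigen : (forall x, \int[mu]_y eigen_defect V x y = 0) ->
  {ae mu, forall x, \int[mu]_y eigen_defect U x y = 0}.
Proof.
move=> V0.
have bU := bmeas_int2 mu mu (bmeas_eigen_defect kU).
apply: (bint_sqr_eq0 (P := mu) bU).
rewrite -eigen_density//.
rewrite (bint_graph_poly kU kV UV (graph_polyM
    (graph_poly_eigen_defect (n := 3) (i := 2) (j := 0) isT isT)
    (graph_poly_eigen_defect (n := 3) (i := 2) (j := 1) isT isT)))//.
rewrite eigen_density// -[RHS](bint_cst mu 0).
by apply: eq_Rintegral => x _; rewrite V0 expr0n.
Qed.

Lemma forced_defect lam : (forall x y, defect lam V x y = 0) ->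
  {ae (mu \x mu)%E, forall z, defect lam U z.1 z.2 = 0}.
Proof.
move=> V0; apply: (codegree_eq0 (bmeas_defect lam kU)) => /=.
rewrite -cycle_density//.
rewrite (bint_graph_poly kU kV UV (graph_polyM
  (graph_polyM (graph_poly_defect lam (n := 4) (i := 0) (j := 2) isT isT)
               (graph_poly_defect lam (n := 4) (i := 0) (j := 3) isT isT))
  (graph_polyM (graph_poly_defect lam (n := 4) (i := 1) (j := 2) isT isT)
               (graph_poly_defect lam (n := 4) (i := 1) (j := 3) isT isT))))//.
rewrite -[RHS](bint_cst (leb01n R 4) 0).
by apply: eq_Rintegral => t _; rewrite V0 !mul0r.
Qed.

End Forcing.
End ForcingPolynomials.

(** * The target kernel *)
Section LebesgueOnUnitInterval.
Context {R : realType}.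
Local Notation Rm := (measurableTypeR R).
Local Notation mu := (@leb01 R).

Lemma ae_leb01_unitI (Q : R -> Prop) : (forall x, unitI x -> Q x) ->
  {ae mu, forall x, Q x}.
Proof.
move=> UQ; exists (~` unitI); split.
- exact: measurableC (@measurable_unitI R).
- by rewrite /leb01 /mrestr setICl measure0.
- by move=> x /= nQ Ux; apply: nQ; exact: UQ.
Qed.

Lemma bint_leb01 (f : R -> R) : bmeas (f : Rm -> R) ->
  \int[mu]_x f x = \int[@lebesgue_measure R]_(x in unitI) f x.
Proof.
move=> bf; have mU := @measurable_unitI R.
transitivity (\int[mu]_(x in unitI) f x).
  rewrite [RHS]Rintegral_mkcond.
  have -> : (f \_ unitI) = (fun t => \1_unitI t * f t).
    apply/funext => t; rewrite /patch indicE; case: ifPn => _; first by rewrite mul1r.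
    by rewrite mul0r.
  apply: bint_ae_eq => //; first by apply: bmeasM => //; exact: bmeas_indic.
  by apply: ae_leb01_unitI => x Ux; rewrite indicE mem_set//= mul1r.
congr fine; apply: eq_measure_integral => A mA AU.
change (@lebesgue_measure R (A `&` unitI) = @lebesgue_measure R A); by rewrite setIidl.
Qed.

Lemma bmeas_cos_comp d (T : measurableType d) (f : T -> R) :
  measurable_fun setT f -> bmeas (fun x => cos (f x)).
Proof.
move=> mf; split; last by exists 1 => x; rewrite ler_norml cos_geN1 cos_le1.
apply: (measurableT_comp (f := cos)) => //.
exact: continuous_measurable_fun (@continuous_cos R).
Qed.

Definition cosn (n : nat) (x : R) : R := cos (n%:R * pi * x).

Lemma bmeas_cosn n : bmeas (cosn n : Rm -> R).
Proof. by apply: bmeas_cos_comp; exact: measurable_funM. Qed.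

Lemma sin_npi n : sin (n%:R * pi) = 0 :> R.
Proof.
elim: n => [|n IHn]; first by rewrite mul0r sin0.
by rewrite -natr1 mulrDl mul1r sinD IHn sinpi mul0r mulr0 addr0.
Qed.

Lemma bint_cosn n : (0 < n)%N -> \int[mu]_x cosn n x = 0.
Proof.
move=> n0; rewrite (bint_leb01 (bmeas_cosn n)) /unitI /Rintegral.
pose w : R := n%:R * pi.
have w0 : w != 0 by rewrite mulf_neq0 ?gt_eqF ?pi_gt0// ltr0n.
pose F (x : R) := w^-1 * sin (w * x).
have dF (x : R) : is_derive x (1 : R) F (cosn n x).
  rewrite /F; apply: is_derive_eq.
  by rewrite /cosn -/w /GRing.scale/= mulr1 mulrCA mulVf// mulr1.
have dF' (x : R) : derivable F x 1. by apply: ex_derive; exact: dF.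
rewrite (@continuous_FTC2 _ _ F)//.
- by rewrite /F mulr1 mulr0 sin0 /w sin_npi !mulr0 subee.
- apply: continuous_subspaceT => x; apply: (continuous_comp (g := cos)).
    by apply: continuousM; [exact: cst_continuous | move=> ?; exact: cvg_id].
  exact: continuous_cos.
- have cF : continuous F.
    by move=> x; apply/differentiable_continuous/derivable1_diffP; exact: dF'.
  split.
  + by move=> x _; exact: dF'.
  + by apply: cvg_at_right_filter; exact: cF.
  + by apply: cvg_at_left_filter; exact: cF.
- by move=> x _; rewrite derive1E; apply: derive_val.
Qed.

Lemma cosn0 x : cosn 0 x = 1.
Proof. by rewrite /cosn !mul0r cos0. Qed.

Lemma cosn1 x : cosn 1 x = cos (pi * x).
Proof. by rewrite /cosn mul1r. Qed.

Lemma cosn_mul1 n x : cosn n.+1 x * cosn 1 x = (cosn n.+2 x + cosn n x) / 2.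
Proof.
rewrite /cosn; set b := 1%:R * pi * x; set a := n.+1%:R * pi * x.
have -> : n.+2%:R * pi * x = a + b by rewrite /a /b -[n.+2%:R]natr1; ring.
have -> : n%:R * pi * x = a - b by rewrite /a /b -[n.+1%:R]natr1; ring.
by rewrite cosD cosB; lra.
Qed.

Lemma bint_cosn_mul1 n : \int[mu]_x (cosn n.+1 x * cosn 1 x) = (n == 0)%:R / 2.
Proof.
transitivity (\int[mu]_x (2^-1 * (cosn n.+2 x + cosn n x))).
  by apply: eq_Rintegral => x _; rewrite cosn_mul1 mulrC.
have b := bmeas_cosn; rewrite bintZ; last exact: bmeasD.
rewrite (bintD _ (b _) (b _)) bint_cosn// add0r mulrC; congr (_ / _).
case: n => [|n]; last by rewrite bint_cosn.
by rewrite -[RHS](bint_cst mu 1); apply: eq_Rintegral => x _; rewrite cosn0.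
Qed.

End LebesgueOnUnitInterval.

Section PoissonSeries.
Context {R : realType}.
Local Notation Rm := (measurableTypeR R).
Local Notation mu := (@leb01 R).

Variable lam : R.
Hypothesis lam01 : 0 < lam <= 1 / 128.

Let lam0 : 0 < lam. Proof. by case/andP: lam01. Qed.
Let lamW : lam <= 1 / 128. Proof. by case/andP: lam01. Qed.
Let lam1 : lam < 1. Proof. by have := lamW; lra. Qed.

Definition poisson_den (th : R) := 1 - 2 * lam * cos th + lam ^+ 2.

Definition cos_sum N (th : R) := \sum_(0 <= n < N) lam ^+ n * cos (n%:R * th).

Definition cos_lim (th : R) := (1 - lam * cos th) / poisson_den th.

Lemma poisson_den_ge th : (1 - lam) ^+ 2 <= poisson_den th.
Proof.
rewrite /poisson_den; have := cos_le1 th; have := lam0; nra.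
Qed.

Lemma poisson_den_neq0 th : poisson_den th != 0.
Proof.
rewrite gt_eqF// (lt_le_trans _ (poisson_den_ge th))// exprn_gt0// subr_gt0.
exact: lam1.
Qed.

(** Telescoping: multiplying by the denominator leaves the boundary terms of the
partial sum. *)
Lemma cos_sumE N th : poisson_den th * cos_sum N th =
  1 - lam * cos th - lam ^+ N * cos (N%:R * th)
  + lam ^+ N.+1 * cos (N%:R * th - th).
Proof.
elim: N => [|N IHN].
  by rewrite /cos_sum big_geq// mulr0 mul0r cos0 sub0r cosN expr0 expr1; ring.
rewrite /cos_sum big_nat_recr//= mulrDr -/(cos_sum N th) IHN.
have -> : N.+1%:R * th = N%:R * th + th by rewrite -natr1; ring.
rewrite addrK; set a := N%:R * th; rewrite cosB cosD /poisson_den !exprS; ring.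
Qed.

(** The constant 3 absorbs 1 + lambda over (1 - lambda)^2. *)
Lemma cos_sum_err N th : `|cos_lim th - cos_sum N th| <= 3 * lam ^+ N.
Proof.
have d0 := poisson_den_neq0 th; have dpos := poisson_den_ge th.
have -> : cos_lim th - cos_sum N th =
    (lam ^+ N * cos (N%:R * th) - lam ^+ N.+1 * cos (N%:R * th - th)) / poisson_den th.
  apply: (mulfI d0); rewrite mulrBr cos_sumE /cos_lim.
  by rewrite !(mulrCA (poisson_den th)) divff// !mulr1; ring.
have dp : 0 < poisson_den th by have := lamW; have := lam0; nra.
rewrite normrM normfV (gtr0_norm dp) ler_pdivrMr//.
have lN : 0 <= lam ^+ N by rewrite exprn_ge0// ltW// lam0.
rewrite (le_trans (ler_normB _ _))// !normrM !(ger0_norm lN).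
rewrite (ger0_norm (exprn_ge0 _ (ltW lam0))).
have c1 t : `|cos t| <= 1 :> R by rewrite ler_norml cos_geN1 cos_le1.
apply: (@le_trans _ _ (lam ^+ N + lam ^+ N.+1)).
  by rewrite lerD// ler_piMr// exprn_ge0// ltW// lam0.
rewrite exprS -mulrA (mulrCA 3); have := lamW; have := lam0; nra.
Qed.

Definition tail_sum N (x y : R) :=
  \sum_(2 <= n < N) (lam ^+ n * cos (n%:R * pi * x) * cos (n%:R * pi * y)).

(** The sum of the series over n >= 2: products of cosines become cosines at
pi (x + y) and pi (x - y), and the terms n = 0 and n = 1 are removed. *)
Definition tail_lim (x y : R) :=
  (cos_lim (pi * x + pi * y) + cos_lim (pi * x - pi * y)) / 2
  - 1 - lam * (cos (pi * x) * cos (pi * y)).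

Lemma tail_sumE N x y : tail_sum N.+2 x y =
  (cos_sum N.+2 (pi * x + pi * y) + cos_sum N.+2 (pi * x - pi * y)) / 2
  - 1 - lam * (cos (pi * x) * cos (pi * y)).
Proof.
rewrite /cos_sum !(@big_nat_recl _ _ _ N.+1)// !(@big_nat_recl _ _ _ N)//.
rewrite !expr0 !mul0r !cos0 !mul1r !expr1 /tail_sum big_add1 /= big_add1 /=.
move: (pi : R) => p.
rewrite cosB cosD.
set S1 := \sum_(0 <= i < N) _; set S2 := \sum_(0 <= i < N) _.
set S3 := \sum_(0 <= i < N) _.
have -> : S1 = (S2 + S3) / 2.
  rewrite /S1 /S2 /S3 -big_split big_distrl /=; apply: eq_bigr => i _.
  have -> : i.+2%:R * (p * x + p * y) = i.+2%:R * p * x + i.+2%:R * p * y by ring.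
  have -> : i.+2%:R * (p * x - p * y) = i.+2%:R * p * x - i.+2%:R * p * y by ring.
  by rewrite cosB cosD; field.
by field.
Qed.

Lemma tail_err N x y : `|tail_lim x y - tail_sum N.+2 x y| <= 3 * lam ^+ N.+2.
Proof.
rewrite tail_sumE /tail_lim.
have := cos_sum_err N.+2 (pi * x + pi * y).
have := cos_sum_err N.+2 (pi * x - pi * y).
rewrite !ler_norml => /andP[? ?] /andP[? ?]; apply/andP; split; lra.
Qed.

Lemma WlE x y : Wl lam x y = 1 / 2 + (cos (pi * x) + cos (pi * y)) / 8
  + cos (pi * x) * cos (pi * y) / 16 + tail_lim x y.
Proof.
rewrite /Wl; congr (_ + _); apply: cvg_lim => //.
rewrite -(cvg_shiftn 2) /=.
apply/cvgrPdist_le => e e0.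
have cl : (fun n => 3 * lam ^+ n) @ \oo --> (3 * 0 : R).
  apply: cvgM; first exact: cvg_cst.
  by apply: cvg_expr; rewrite gtr0_norm ?lam0 ?lam1.
rewrite mulr0 in cl.
move/cvgrPdist_le : cl => /(_ _ e0); apply: filterS => n.
rewrite sub0r normrN => hn.
rewrite addn2 (le_trans (tail_err n x y))// (le_trans _ hn)//.
rewrite ger0_norm; last by rewrite mulr_ge0// exprn_ge0// ltW// lam0.
rewrite ler_pM2l//; apply: ler_wiXn2l; [exact: ltW lam0|exact: ltW lam1|].
by rewrite !leqW.
Qed.

Lemma poisson_quadE s t :
  poisson_quad lam (cos s) (cos t) = poisson_den (s + t) * poisson_den (s - t).
Proof.
have := cos2Dsin2 s; have := cos2Dsin2 t; rewrite /poisson_quad /poisson_den cosB cosD.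
set a := cos s; set b := cos t; set p := sin s; set q := sin t => hb ha.
have -> : (1 - 2 * lam * (a * b - p * q) + lam ^+ 2) *
    (1 - 2 * lam * (a * b + p * q) + lam ^+ 2) =
    (1 + lam ^+ 2) ^+ 2 - 4 * lam * (1 + lam ^+ 2) * (a * b)
    + 4 * lam ^+ 2 * (a ^+ 2 * b ^+ 2 - p ^+ 2 * q ^+ 2) by ring.
have -> : p ^+ 2 = 1 - a ^+ 2 by rewrite -ha; ring.
have -> : q ^+ 2 = 1 - b ^+ 2 by rewrite -hb; ring.
by ring.
Qed.

Lemma poisson_quad_gt0 s t : 0 < poisson_quad lam (cos s) (cos t).
Proof.
have dp th : 0 < poisson_den th.
  by rewrite (lt_le_trans _ (poisson_den_ge th))// exprn_gt0// subr_gt0 lam1.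
by rewrite poisson_quadE mulr_gt0.
Qed.

(** With d1 and d2 the two Poisson denominators, both sides are polynomials in
d1, d2 after substituting 2 lambda cos th = 1 + lambda^2 - d. *)
Lemma Wl_closed x y : full_kernel lam (Wl lam x y) (cos (pi * x)) (cos (pi * y)) *
    poisson_quad lam (cos (pi * x)) (cos (pi * y)) =
  (1 - lam ^+ 2) * (1 + lam ^+ 2 - 2 * lam * (cos (pi * x) * cos (pi * y))).
Proof.
rewrite WlE /full_kernel /tail_lim /cos_lim poisson_quadE.
set s := pi * x; set t := pi * y.
have d1 := poisson_den_neq0 (s + t); have d2 := poisson_den_neq0 (s - t).
have -> : cos s * cos t = (cos (s + t) + cos (s - t)) / 2 by rewrite cosB cosD; field.
have e1 : 2 * lam * cos (s + t) = 1 + lam ^+ 2 - poisson_den (s + t).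
  by rewrite /poisson_den; ring.
have e2 : 2 * lam * cos (s - t) = 1 + lam ^+ 2 - poisson_den (s - t).
  by rewrite /poisson_den; ring.
have f1 : lam * cos (s + t) = (1 + lam ^+ 2 - poisson_den (s + t)) / 2 by rewrite -e1; field.
have f2 : lam * cos (s - t) = (1 + lam ^+ 2 - poisson_den (s - t)) / 2 by rewrite -e2; field.
rewrite f1 f2; set A := poisson_den (s + t) in d1 f1 *.
set B := poisson_den (s - t) in d2 f2 *.
have -> : 2 * lam * ((cos (s + t) + cos (s - t)) / 2) = lam * cos (s + t) + lam * cos (s - t).
  by field.
have -> : lam * ((cos (s + t) + cos (s - t)) / 2) = (lam * cos (s + t) + lam * cos (s - t)) / 2.
  by field.
rewrite f1 f2; field.
by rewrite d1 d2.
Qed.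

Lemma bmeas_cos_lim : bmeas (cos_lim : Rm -> R).
Proof.
split; last first.
  exists 3 => th; have := cos_sum_err 0 th.
  by rewrite /cos_sum big_geq// subr0 expr0 mulr1.
apply: continuous_measurable_fun => th.
apply: cvgM.
  by apply: cvgB; [exact: cvg_cst | apply: cvgM; [exact: cvg_cst | exact: continuous_cos]].
apply: cvgV; first exact: poisson_den_neq0.
apply: cvgD; last exact: cvg_cst.
by apply: cvgB; [exact: cvg_cst | apply: cvgM; [exact: cvg_cst | exact: continuous_cos]].
Qed.

Lemma bmeas_tail_lim : bmeas (fun z : Rm * Rm => tail_lim z.1 z.2).
Proof.
have m1 : measurable_fun setT (fun z : Rm * Rm => pi * z.1 : Rm).
  by apply: measurable_funM => //; exact: measurable_fst.
have m2 : measurable_fun setT (fun z : Rm * Rm => pi * z.2 : Rm).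
  by apply: measurable_funM => //; exact: measurable_snd.
have bc c : bmeas (fun _ : Rm * Rm => c : R) := bmeas_cst c.
apply: bmeasB.
  apply: bmeasB => //; apply: bmeasM => //; apply: bmeasD.
    by apply: (bmeas_comp bmeas_cos_lim); exact: measurable_funD.
  by apply: (bmeas_comp bmeas_cos_lim); exact: measurable_funB.
by apply: bmeasZ; apply: bmeasM; exact: bmeas_cos_comp.
Qed.

Lemma total_kernel_Wl : total_kernel (Wl lam).
Proof.
have bc c : bmeas (fun _ : Rm * Rm => c : R) := bmeas_cst c.
have m1 : measurable_fun setT (fun z : Rm * Rm => pi * z.1 : Rm).
  by apply: measurable_funM => //; exact: measurable_fst.
have m2 : measurable_fun setT (fun z : Rm * Rm => pi * z.2 : Rm).
  by apply: measurable_funM => //; exact: measurable_snd.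
have b1 := bmeas_cos_comp m1; have b2 := bmeas_cos_comp m2.
split.
  rewrite (_ : (fun z => _) = (fun z : Rm * Rm => 1 / 2 +
    (cos (pi * z.1) + cos (pi * z.2)) / 8
    + cos (pi * z.1) * cos (pi * z.2) / 16 + tail_lim z.1 z.2)).
    apply: bmeasD; last exact: bmeas_tail_lim.
    apply: bmeasD; last by apply: bmeasM => //; exact: bmeasM.
    by apply: bmeasD => //; apply: bmeasM => //; exact: bmeasD.
  by apply/funext => z; rewrite WlE.
move=> x y; rewrite !WlE /tail_lim.
have -> : cos_lim (pi * x - pi * y) = cos_lim (pi * y - pi * x).
  by rewrite /cos_lim /poisson_den -[pi * x - _]opprB cosN.
by rewrite (addrC (pi * x)) (addrC (cos (pi * x))) (mulrC (cos (pi * x))).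
Qed.

(** Term-by-term integration of the series, from the uniform bound [tail_err] on
its remainders. *)
Lemma bint_tail_orth (g : R -> R) x : bmeas (g : Rm -> R) -> (forall y, `|g y| <= 1) ->
  (forall n, \int[mu]_y (cosn n.+2 y * g y) = 0) ->
  \int[mu]_y (tail_lim x y * g y) = 0.
Proof.
move=> bg g1 orth; apply/eqP; rewrite -normr_le0.
have cl : (fun n => 3 * lam ^+ n) @ \oo --> (3 * 0 : R).
  apply: cvgM; first exact: cvg_cst.
  by apply: cvg_expr; rewrite gtr0_norm ?lam0 ?lam1.
rewrite -[leRHS](mulr0 (3 : R)).
apply: (ler_cvg_to (cvg_cst _) cl); apply: nearW => N.
have bt : bmeas (fun y : Rm => tail_lim x y) := bmeas_section1 bmeas_tail_lim x.
have bts : bmeas (fun y : Rm => tail_sum N.+2 x y).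
  by apply: bmeas_sum => n; apply: bmeasZ; exact: bmeas_cosn.
have sum0 : \int[mu]_y (tail_sum N.+2 x y * g y) = 0.
  transitivity (\int[mu]_y \sum_(2 <= n < N.+2)
      (lam ^+ n * cos (n%:R * pi * x)) * (cosn n y * g y)).
    apply: eq_Rintegral => y _; rewrite /tail_sum big_distrl /=.
    by apply: eq_bigr => n _; rewrite mulrA.
  have bcg n : bmeas (fun y : Rm => cosn n y * g y).
    by apply: bmeasM => //; exact: bmeas_cosn.
  rewrite bint_sum; last by move=> n; exact: bmeasZ.
  rewrite big_nat; apply: big1 => -[|[|n]]//= _.
  by rewrite bintZ// orth mulr0.
rewrite -[X in `|X|]subr0 -[X in _ - X]sum0 -bintB; first last.
- exact: bmeasM.
- exact: bmeasM.
apply: bint_le_bound; first by apply: bmeasB; exact: bmeasM.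
move=> y; rewrite -mulrBl normrM -[leRHS]mulr1 ler_pM//.
rewrite (le_trans (tail_err N x y))// ler_pM2l//.
apply: ler_wiXn2l; [exact: ltW lam0|exact: ltW lam1|].
by rewrite !leqW.
Qed.

Lemma degree_Wl x : degree (Wl lam) x = 1 / 2 + cos (pi * x) / 8.
Proof.
set a := cos (pi * x).
have bt : bmeas (fun y : Rm => tail_lim x y) := bmeas_section1 bmeas_tail_lim x.
transitivity (\int[mu]_y ((1 / 2 + a / 8) + (1 / 8 + a / 16) * cosn 1 y + tail_lim x y)).
  by apply: eq_Rintegral => y _; rewrite WlE -/a cosn1; field.
have bc c : bmeas (fun _ : Rm => c : R) := bmeas_cst c.
have b1 : bmeas (fun y : Rm => (1 / 8 + a / 16) * cosn 1 y).
  by apply: bmeasZ; exact: bmeas_cosn.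
rewrite (bintD _ (bmeasD (bc _) b1) bt) (bintD _ (bc _) b1) bint_cst.
rewrite bintZ ?bint_cosn//; last exact: bmeas_cosn.
have -> : \int[mu]_y tail_lim x y = \int[mu]_y (tail_lim x y * 1).
  by apply: eq_Rintegral => y _; rewrite mulr1.
rewrite bint_tail_orth; [by rewrite mulr0 !addr0 | exact: bc | by move=> y; rewrite normr1 |].
move=> n; rewrite -[RHS](@bint_cosn R n.+2)//.
by apply: eq_Rintegral => y _; rewrite mulr1.
Qed.

Lemma hdeg_Wl x : hdeg (Wl lam) x = cos (pi * x).
Proof. by rewrite /hdeg degree_Wl; field. Qed.

Lemma defect_Wl x y : defect lam (Wl lam) x y = 0.
Proof. by rewrite /defect !hdeg_Wl Wl_closed subrr. Qed.

Lemma eigen_defect_Wl x : \int[mu]_y eigen_defect (Wl lam) x y = 0.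
Proof.
set a := cos (pi * x).
have bt : bmeas (fun y : Rm => tail_lim x y) := bmeas_section1 bmeas_tail_lim x.
have bc c : bmeas (fun _ : Rm => c : R) := bmeas_cst c.
have bk := @bmeas_cosn R.
transitivity (\int[mu]_y (- (1 / 16 + a / 32) + (1 / 2 + a / 8) * cosn 1 y
    + (1 / 8 + a / 16) * (cosn 1 y * cosn 1 y) + tail_lim x y * cosn 1 y)).
  apply: eq_Rintegral => y _; rewrite /eigen_defect !hdeg_Wl (proj2 total_kernel_Wl).
  by rewrite WlE -/a cosn1; field.
have b1 : bmeas (fun y : Rm => (1 / 2 + a / 8) * cosn 1 y) by exact: bmeasZ.
have b2 : bmeas (fun y : Rm => (1 / 8 + a / 16) * (cosn 1 y * cosn 1 y)).
  by apply: bmeasZ; exact: bmeasM.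
have b3 : bmeas (fun y : Rm => tail_lim x y * cosn 1 y) by exact: bmeasM.
have b01 := bmeasD (bc (- (1 / 16 + a / 32))) b1.
rewrite (bintD _ (bmeasD b01 b2) b3) (bintD _ b01 b2) (bintD _ (bc _) b1) bint_cst.
rewrite (bintZ _ _ (bk 1)) (bintZ _ _ (bmeasM (bk 1) (bk 1))) bint_cosn//.
rewrite (bint_cosn_mul1 0) bint_tail_orth.
- by rewrite /=; field.
- exact: bk.
- by move=> y; rewrite ler_norml cos_geN1 cos_le1.
- by move=> n; rewrite (bint_cosn_mul1 n.+1) mul0r.
Qed.

Lemma mean_Wl : \int[mu]_x hdeg (Wl lam) x = 0.
Proof.
rewrite -[RHS](@bint_cosn R 1)//; apply: eq_Rintegral => x _.
by rewrite hdeg_Wl cosn1.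
Qed.

Lemma square_Wl : \int[mu]_x (hdeg (Wl lam) x * hdeg (Wl lam) x) = 1 / 2.
Proof.
rewrite -[RHS](@bint_cosn_mul1 R 0); apply: eq_Rintegral => x _.
by rewrite !hdeg_Wl cosn1.
Qed.

End PoissonSeries.

(** * Chebyshev polynomials of the degree function *)
Section Chebyshev.
Context {R : realType}.

Fixpoint cheb (n : nat) (t : R) : R :=
  match n with
  | 0 => 1
  | n1.+1 => match n1 with 0 => t | n2.+1 => 2 * t * cheb n1 t - cheb n2 t end
  end.

Lemma chebSS n t : cheb n.+2 t = 2 * t * cheb n.+1 t - cheb n t.
Proof. by []. Qed.

Lemma mul_cheb n t : t * cheb n.+1 t = (cheb n.+2 t + cheb n t) / 2.
Proof. by rewrite chebSS; field. Qed.

Lemma cheb_cos n (x : R) : cheb n (cos (pi * x)) = cosn n x.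
Proof.
suff: cheb n (cos (pi * x)) = cosn n x /\ cheb n.+1 (cos (pi * x)) = cosn n.+1 x.
  by case.
elim: n => [|n [IH1 IH2]]; first by rewrite cosn0 cosn1.
split=> //; rewrite chebSS IH1 IH2 -cosn1.
by have := cosn_mul1 n x => h; rewrite -mulrA [cosn 1 x * _]mulrC h; field.
Qed.

Lemma bmeas_cheb d (T : measurableType d) (X : T -> R) n :
  bmeas X -> bmeas (fun x => cheb n (X x)).
Proof.
move=> bX.
suff: bmeas (fun x => cheb n (X x)) /\ bmeas (fun x => cheb n.+1 (X x)) by case.
elim: n => [|n [IH1 IH2]]; first by split => //; exact: bmeas_cst.
by split=> //; apply: bmeasB => //; apply: bmeasM => //; exact: bmeasZ.
Qed.

(** By induction on k, the integrals of X^k T_n(X) agree for all n, since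
X T_n(X) is the mean of T_(n+1)(X) and T_(n-1)(X); n = 0 gives the moments. *)
Lemma moments_of_cheb d1 d2 (T1 : measurableType d1) (T2 : measurableType d2)
    (P1 : probability T1 R) (P2 : probability T2 R) (X : T1 -> R) (Y : T2 -> R) :
  bmeas X -> bmeas Y ->
  (forall n, \int[P1]_x cheb n (X x) = \int[P2]_y cheb n (Y y)) ->
  forall k, \int[P1]_x X x ^+ k = \int[P2]_y Y y ^+ k.
Proof.
move=> bX bY chebE k.
suff key n : \int[P1]_x (X x ^+ k * cheb n (X x)) = \int[P2]_y (Y y ^+ k * cheb n (Y y)).
  have e d (T : measurableType d) (P : probability T R) (Z : T -> R) :
      \int[P]_x Z x ^+ k = \int[P]_x (Z x ^+ k * cheb 0 (Z x)).
    by apply: eq_Rintegral => x _; rewrite mulr1.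
  by rewrite !e key.
elim: k n => [|k IHk] n.
  have e d (T : measurableType d) (P : probability T R) (Z : T -> R) :
      \int[P]_x (Z x ^+ 0 * cheb n (Z x)) = \int[P]_x cheb n (Z x).
    by apply: eq_Rintegral => x _; rewrite expr0 mul1r.
  by rewrite !e chebE.
case: n => [|n].
  have e d (T : measurableType d) (P : probability T R) (Z : T -> R) :
      \int[P]_x (Z x ^+ k.+1 * cheb 0 (Z x)) = \int[P]_x (Z x ^+ k * cheb 1 (Z x)).
    by apply: eq_Rintegral => x _; rewrite mulr1 exprSr.
  by rewrite !e IHk.
have e d (T : measurableType d) (P : probability T R) (Z : T -> R) : bmeas Z ->
    \int[P]_x (Z x ^+ k.+1 * cheb n.+1 (Z x)) =
    2^-1 * (\int[P]_x (Z x ^+ k * cheb n.+2 (Z x)) + \int[P]_x (Z x ^+ k * cheb n (Z x))).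
  move=> bZ.
  have b m : bmeas (fun x => Z x ^+ k * cheb m (Z x)).
    by apply: bmeasM; [exact: bmeasX | exact: bmeas_cheb].
  rewrite -(bintD _ (b _) (b _)) -bintZ; last exact: bmeasD.
  apply: eq_Rintegral => x _; rewrite exprSr -mulrA mul_cheb; by field.
by rewrite !e// !IHk.
Qed.

End Chebyshev.

(** * The forced identities make Chebyshev polynomials eigenfunctions *)
Section Eigenfunctions.
Context {R : realType}.
Local Notation Rm := (measurableTypeR R).
Local Notation mu := (@leb01 R).
Variables (lam : R) (U : R -> R -> R).
Hypothesis lam01 : 0 < lam < 1.
Hypothesis kU : total_kernel U.
Local Notation h := (hdeg U).
Hypothesis mean0 : \int[mu]_x h x = 0.
Hypothesis square : \int[mu]_x (h x * h x) = 1 / 2.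
Hypothesis eigen : {ae mu, forall x, \int[mu]_y eigen_defect U x y = 0}.
Hypothesis kernelE : {ae (mu \x mu)%E, forall z, defect lam U z.1 z.2 = 0}.

Let bh : bmeas (h : Rm -> R). Proof. exact: bmeas_hdeg. Qed.
Let bc (c : R) : bmeas (fun _ : Rm => c). Proof. exact: bmeas_cst. Qed.
Let bT n : bmeas (fun x : Rm => cheb n (h x)). Proof. exact: bmeas_cheb. Qed.
Let bU x : bmeas (fun y : Rm => U x y). Proof. exact: (bmeas_section1 (proj1 kU) x). Qed.

Definition ker (x y : R) : R := full_kernel lam (U x y) (h x) (h y).

Lemma kerC x y : ker x y = ker y x.
Proof. by rewrite /ker /full_kernel (proj2 kU x y) [h y * _]mulrC [h y + _]addrC. Qed.

Lemma bmeas_ker : bmeas (fun z : Rm * Rm => ker z.1 z.2).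
Proof. exact: bmeas_full_kernel. Qed.

Definition ker_op (f : R -> R) (x : R) : R := \int[mu]_y (ker x y * f y).

Let bker x : bmeas (fun y : Rm => ker x y). Proof. exact: (bmeas_section1 bmeas_ker x). Qed.

Lemma bmeas_ker_mul f : bmeas (f : Rm -> R) ->
  bmeas (fun z : Rm * Rm => ker z.1 z.2 * f z.2).
Proof.
by move=> bf; apply: bmeasM; [exact: bmeas_ker | exact: (bmeas_comp bf)].
Qed.

Lemma bmeas_ker_op f : bmeas (f : Rm -> R) -> bmeas (ker_op f : Rm -> R).
Proof. by move=> bf; exact: (bmeas_int2 mu mu (bmeas_ker_mul bf)). Qed.

Lemma ker_op_lin f g (a b : R) x : bmeas (f : Rm -> R) -> bmeas (g : Rm -> R) ->
  ker_op (fun y => a * f y + b * g y) x = a * ker_op f x + b * ker_op g x.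
Proof.
move=> bf bg; have bkf := bmeasM (bker x) bf; have bkg := bmeasM (bker x) bg.
rewrite /ker_op -(bintZ _ a bkf) -(bintZ _ b bkg) -bintD; [|exact: bmeasZ..].
by apply: eq_Rintegral => y _; ring.
Qed.

Lemma ker_op_sym f g : bmeas (f : Rm -> R) -> bmeas (g : Rm -> R) ->
  \int[mu]_x (ker_op f x * g x) = \int[mu]_x (f x * ker_op g x).
Proof.
move=> bf bg.
have b : bmeas (fun z : Rm * Rm => g z.1 * (ker z.1 z.2 * f z.2)).
  by apply: bmeasM; [exact: (bmeas_comp bg) | exact: bmeas_ker_mul].
transitivity (\int[mu]_x \int[mu]_y (g x * (ker x y * f y))).
  apply: eq_Rintegral => x _; rewrite mulrC -bintZ//.
  exact: bmeasM (bker x) bf.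
rewrite (bint_swap mu mu b) /=; apply: eq_Rintegral => y _.
rewrite -bintZ; last exact: bmeasM (bker y) bg.
by apply: eq_Rintegral => x _; rewrite kerC; ring.
Qed.

(** Both conditions hold almost everywhere; the second one says that the defect
vanishes at (x, y) for almost every y.  The exceptional null set is fixed here,
once for all the eigenvalue equations. *)
Definition good (x : R) : Prop :=
  \int[mu]_y eigen_defect U x y = 0 /\ \int[mu]_y defect lam U x y ^+ 2 = 0.

Lemma ae_good : {ae mu, forall x, good x}.
Proof.
have bd := bmeas_defect lam kU; have bd2 := bmeasX 2 bd.
have : {ae mu, forall x, \int[mu]_y defect lam U x y ^+ 2 = 0}.
  apply: (bint_eq0 (bmeas_int2 mu mu bd2)) => [x|].
    by apply: Rintegral_ge0 => y _; exact: sqr_ge0.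
  rewrite -(bint_prod12 mu mu bd2) -[RHS](bint_cst (mu \x mu)%E 0).
  apply: (bint_ae_eq (P := (mu \x mu)%E)) => //; first exact: bmeas_cst.
  by apply: (aeS (P := (mu \x mu)%E)) kernelE => z ->; rewrite expr0n.
by move=> d0; apply: (aeS2 (P := mu)) eigen d0 => x.
Qed.

(** Integrate the defect identity against p in its second variable.  With M the
multiplication by h and D the operator of kernel ker, this expresses D M^2 p
through D p and D M p, up to terms that vanish when p is orthogonal to 1
and h. *)
Lemma ker_op_relation x p : good x -> bmeas (p : Rm -> R) ->
  ((1 - lam ^+ 2) ^+ 2 + 4 * lam ^+ 2 * (h x * h x)) * ker_op p x
  - 4 * lam * (1 + lam ^+ 2) * h x * ker_op (fun y => h y * p y) x
  + 4 * lam ^+ 2 * ker_op (fun y => h y * (h y * p y)) x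
  = (1 - lam ^+ 2) * (1 + lam ^+ 2) * \int[mu]_y p y
    - 2 * lam * (1 - lam ^+ 2) * h x * \int[mu]_y (h y * p y).
Proof.
move=> [_ d0] bp.
have bd : bmeas (fun y : Rm => defect lam U x y).
  exact: (bmeas_section1 (bmeas_defect lam kU) x).
have ae0 : {ae mu, forall y, defect lam U x y = 0} := bint_sqr_eq0 bd d0.
have : \int[mu]_y (defect lam U x y * p y) = 0.
  rewrite -[RHS](bint_cst mu 0); apply: bint_ae_eq => //; first exact: bmeasM.
  by apply: (aeS (P := mu)) ae0 => y ->; rewrite mul0r.
have bhp : bmeas (fun y : Rm => h y * p y) by exact: bmeasM.
have bhhp : bmeas (fun y : Rm => h y * (h y * p y)) by exact: bmeasM.
have k0 := bmeasM (bker x) bp; have k1 := bmeasM (bker x) bhp.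
have k2 := bmeasM (bker x) bhhp.
pose c0 := (1 - lam ^+ 2) ^+ 2 + 4 * lam ^+ 2 * (h x * h x).
pose c1 := - (4 * lam * (1 + lam ^+ 2) * h x).
pose c2 := 4 * lam ^+ 2.
pose e0 := - ((1 - lam ^+ 2) * (1 + lam ^+ 2)).
pose e1 := 2 * lam * (1 - lam ^+ 2) * h x.
have -> : \int[mu]_y (defect lam U x y * p y) =
    \int[mu]_y (c0 * (ker x y * p y) + c1 * (ker x y * (h y * p y))
     + c2 * (ker x y * (h y * (h y * p y))) + e0 * p y + e1 * (h y * p y)).
  apply: eq_Rintegral => y _; rewrite /defect -/(ker x y) /poisson_quad.
  by rewrite /c0 /c1 /c2 /e0 /e1; ring.
have z0 := bmeasZ c0 k0; have z1 := bmeasZ c1 k1; have z2 := bmeasZ c2 k2.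
have z3 := bmeasZ e0 bp; have z4 := bmeasZ e1 bhp.
have z01 := bmeasD z0 z1; have z012 := bmeasD z01 z2; have z0123 := bmeasD z012 z3.
rewrite (bintD _ z0123 z4) (bintD _ z012 z3) (bintD _ z01 z2) (bintD _ z0 z1).
rewrite (bintZ _ _ k0) (bintZ _ _ k1) (bintZ _ _ k2) (bintZ _ _ bp) (bintZ _ _ bhp).
rewrite -/(ker_op p x) -/(ker_op (fun y => h y * p y) x) -/(ker_op (fun y => h y * (h y * p y)) x).
rewrite /c0 /c1 /c2 /e0 /e1 => E; apply/eqP; rewrite -subr_eq0 -[X in _ == X]E.
by apply/eqP; ring.
Qed.

Lemma ker_op_cheb0 x : ker_op (fun y => cheb 0 (h y)) x = 1.
Proof.
pose c0 := 2 * (- (1 / 2) - h x / 8) + 1.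
pose c1 := - (1 / 4) - h x / 8 + 2 * lam * h x.
transitivity (\int[mu]_y (c0 + 2 * U x y + c1 * h y)).
  by apply: eq_Rintegral => y _; rewrite /ker /full_kernel /c0 /c1 /=; field.
have z0 := bmeasZ 2 (bU x); have z1 := bmeasD (bc c0) z0; have z2 := bmeasZ c1 bh.
rewrite (bintD _ z1 z2) (bintD _ (bc c0) z0) (bintZ _ _ (bU x)) (bintZ _ _ bh).
by rewrite mean0 bint_cst -/(degree U x) /c0 /hdeg; field.
Qed.

Lemma ker_op_cheb1 x : good x -> ker_op (fun y => cheb 1 (h y)) x = lam * h x.
Proof.
move=> [eig _].
pose c0 := 2 * (- (1 / 2) - h x / 8) + 1.
pose c1 := - (1 / 4) - h x / 8 + 2 * lam * h x.
have bUh : bmeas (fun y : Rm => U y x * h y).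
  rewrite (_ : (fun y => _) = (fun y => U x y * h y)); first exact: bmeasM.
  by apply/funext => y; rewrite (proj2 kU).
have Uh : \int[mu]_y (U y x * h y) = 1 / 16 + h x / 32.
  have := eig; rewrite /eigen_defect (bintB _ (bmeasB bUh (bc _)) (bc _)).
  by rewrite (bintB _ bUh (bc _)) !bint_cst; lra.
have bhh := bmeasM bh bh.
transitivity (\int[mu]_y (c0 * h y + 2 * (U y x * h y) + c1 * (h y * h y))).
  apply: eq_Rintegral => y _; rewrite (proj2 kU y x) /ker /full_kernel /c0 /c1 /=.
  by field.
have z0 := bmeasZ c0 bh; have z1 := bmeasZ 2 bUh; have z2 := bmeasZ c1 bhh.
rewrite (bintD _ (bmeasD z0 z1) z2) (bintD _ z0 z1) !bintZ//.
by rewrite mean0 square Uh /c1; field.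
Qed.

Definition eigen_at n := forall x, good x ->
  ker_op (fun y => cheb n (h y)) x = lam ^+ n * cheb n (h x).

(** D is symmetric and the eigenvalues lambda^n are pairwise distinct. *)
Lemma eigen_orth m n : (m < n)%N -> eigen_at m -> eigen_at n ->
  \int[mu]_x (cheb n (h x) * cheb m (h x)) = 0.
Proof.
move=> mn em en; have [lam0 lam1] := andP lam01.
have := ker_op_sym (bT n) (bT m).
have aeE (f g : R -> R) : bmeas (f : Rm -> R) -> bmeas (g : Rm -> R) ->
    (forall x, good x -> f x = g x) -> \int[mu]_x f x = \int[mu]_x g x.
  by move=> bf bg fg; apply: (bint_ae_eq (P := mu)) => //; apply: (aeS (P := mu)) ae_good.
have bn := bT n; have bm := bT m.
have bnm := bmeasM bn bm.
have on := bmeas_ker_op bn; have om := bmeas_ker_op bm.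
rewrite (aeE _ (fun x => lam ^+ n * (cheb n (h x) * cheb m (h x)))); first last.
- by move=> x gx; rewrite en// mulrA.
- exact: bmeasZ.
- exact: bmeasM.
rewrite (aeE (fun x => cheb n (h x) * _)
  (fun x => lam ^+ m * (cheb n (h x) * cheb m (h x)))); first last.
- by move=> x gx; rewrite em// mulrCA.
- exact: bmeasZ.
- exact: bmeasM.
rewrite !bintZ// => /eqP; rewrite -subr_eq0 -mulrBl mulf_eq0 => /orP[|/eqP //].
by rewrite subr_eq0 => /eqP E; have := ltr_iXn2l lam0 lam1 n m; rewrite E ltxx mn.
Qed.

Lemma bint_cheb_mean n : eigen_at n.+1 -> \int[mu]_x cheb n.+1 (h x) = 0.
Proof.
move=> en; have e0 : eigen_at 0 by move=> x _; rewrite ker_op_cheb0 expr0 mul1r.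
rewrite -[RHS](eigen_orth (ltn0Sn n) e0 en); apply: eq_Rintegral => x _.
by rewrite mulr1.
Qed.

(** [ker_op_relation] at p = T_(n+2)(h): h^2 T_(n+2)(h) has T_(n+4)(h) as its only
unknown component, and the right-hand side vanishes by [eigen_orth]. *)
Lemma eigen_step n : eigen_at n -> eigen_at n.+1 -> eigen_at n.+2 -> eigen_at n.+3 ->
  eigen_at n.+4.
Proof.
move=> e0 e1 e2 e3 x gx; have [lam0 lam1] := andP lam01.
have E1 : eigen_at 1 by move=> y gy; rewrite ker_op_cheb1// expr1.
have := ker_op_relation gx (bT n.+2).
rewrite (bint_cheb_mean e2).
have -> : \int[mu]_y (h y * cheb n.+2 (h y)) = 0.
  rewrite -[RHS](eigen_orth (m := 1) (n := n.+2) _ E1 e2)//.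
  by apply: eq_Rintegral => y _; rewrite mulrC.
have -> : (fun y => h y * cheb n.+2 (h y)) =
    (fun y => 2^-1 * cheb n.+3 (h y) + 2^-1 * cheb n.+1 (h y)).
  by apply/funext => y; rewrite mul_cheb; field.
have -> : (fun y => h y * (h y * cheb n.+2 (h y))) =
    (fun y => 4^-1 * cheb n.+4 (h y) + 1 * (2^-1 * cheb n.+2 (h y) + 4^-1 * cheb n (h y))).
  apply/funext => y; rewrite mul_cheb mulrA mulrDr !mul_cheb; by field.
rewrite !ker_op_lin//; last first.
  by apply: bmeasD; exact: bmeasZ.
rewrite e0// e1// e2// e3// (exprS _ n.+3) (exprS _ n.+2) (exprS _ n.+1) (exprS _ n).
rewrite !chebSS; set a := h x; set u := cheb n.+1 a; set v := cheb n a.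
set X := ker_op _ _ => E.
have l2 : lam ^+ 2 != 0 by rewrite expf_neq0// gt_eqF.
apply: (mulfI l2); apply/eqP; rewrite -subr_eq0; apply/eqP.
by rewrite !mulr0 subr0 in E; rewrite -[RHS]E; field.
Qed.

(** The cases 2 and 3 use the same relation at p = 1 and p = h, whose integrals
against 1 and h do not all vanish but are given by the first two moments. *)
Lemma eigen_all n : eigen_at n.
Proof.
have e0 : eigen_at 0 by move=> x _; rewrite ker_op_cheb0 expr0 mul1r.
have e1 : eigen_at 1 by move=> y gy; rewrite ker_op_cheb1// expr1.
have [lam0 lam1] := andP lam01.
have l2 : lam ^+ 2 != 0 by rewrite expf_neq0// gt_eqF.
have e2 : eigen_at 2.
  move=> x gx; have := ker_op_relation gx (bT 0).
  have -> : \int[mu]_y cheb 0 (h y) = 1 by rewrite bint_cst.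
  have -> : (fun y => h y * cheb 0 (h y)) = (fun y => cheb 1 (h y)).
    by apply/funext => y; rewrite mulr1.
  have -> : (fun y => h y * (h y * cheb 0 (h y))) =
      (fun y => 2^-1 * cheb 2 (h y) + 2^-1 * cheb 0 (h y)).
    by apply/funext => y /=; field.
  rewrite mean0 ker_op_lin// e0// e1//; set X := ker_op _ _ => E.
  apply: (mulfI l2); apply/eqP; rewrite -subr_eq0; apply/eqP.
  apply: (@mulfI _ 2); first by rewrite pnatr_eq0.
  move/eqP: E; rewrite -subr_eq0 => /eqP E; rewrite mulr0 -[RHS]E /=; by field.
have e3 : eigen_at 3.
  move=> x gx; have := ker_op_relation gx (bT 1).
  have -> : \int[mu]_y cheb 1 (h y) = 0 by rewrite mean0.
  have -> : \int[mu]_y (h y * cheb 1 (h y)) = 1 / 2 by rewrite square.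
  have -> : (fun y => h y * cheb 1 (h y)) =
      (fun y => 2^-1 * cheb 2 (h y) + 2^-1 * cheb 0 (h y)).
    by apply/funext => y /=; field.
  have -> : (fun y => h y * (h y * cheb 1 (h y))) =
      (fun y => 4^-1 * cheb 3 (h y) + 3 / 4 * cheb 1 (h y)).
    by apply/funext => y /=; field.
  rewrite !ker_op_lin// e0// e1// e2//; set X := ker_op _ _ => E.
  apply: (mulfI l2); apply/eqP; rewrite -subr_eq0; apply/eqP.
  move/eqP: E; rewrite -subr_eq0 => /eqP E; rewrite -[RHS]E /=; by field.
suff : [/\ eigen_at n, eigen_at n.+1, eigen_at n.+2 & eigen_at n.+3] by case.
elim: n => [//|n [i0 i1 i2 i3]]; split => //; exact: eigen_step.
Qed.

Lemma bint_cheb n : \int[mu]_x cheb n (h x) = (n == 0)%:R.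
Proof.
case: n => [|n]; first by rewrite bint_cst.
by rewrite bint_cheb_mean//; exact: eigen_all.
Qed.

End Eigenfunctions.

(** * The measure-preserving map *)
Section Angle.
Context {R : realType}.

Definition clip (t : R) : R := Num.max (-1) (Num.min t 1).

(** The inverse of x |-> cos (pi x) on [0, 1], extended by constants outside
[-1, 1] so that it is monotone on the whole line and takes values in [0, 1]. *)
Definition angle (t : R) : R := acos (clip t) / pi.

Lemma clip_itv t : -1 <= clip t <= 1.
Proof. by rewrite /clip le_max lexx ge_max ge_min lexx orbT andbT/=; lra. Qed.

Lemma clip_id t : -1 <= t <= 1 -> clip t = t.
Proof. by move=> /andP[t1 t2]; rewrite /clip min_l// max_r. Qed.

Lemma angle_itv t : unitI (angle t).
Proof.
rewrite /unitI /= in_itv/= /angle divr_ge0 ?acos_ge0 ?clip_itv ?pi_ge0//=.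
by rewrite ler_pdivrMr ?pi_gt0// mul1r acos_lepi// clip_itv.
Qed.

Lemma cos_angle t : -1 <= t <= 1 -> cos (pi * angle t) = t.
Proof.
by move=> t1; rewrite /angle mulrC divfK ?gt_eqF ?pi_gt0// clip_id// acosK.
Qed.

Lemma angle_cos x : unitI x -> angle (cos (pi * x)) = x.
Proof.
rewrite /unitI /= in_itv/= => /andP[x0 x1].
rewrite /angle clip_id ?cos_geN1 ?cos_le1// cosK; last first.
  by rewrite in_itv/= mulr_ge0 ?pi_ge0//= ler_piMr// pi_ge0.
by rewrite mulrC mulKf// gt_eqF// pi_gt0.
Qed.

Lemma angle_nonincreasing : nonincreasing_fun angle.
Proof.
move=> s t st; rewrite /angle ler_pM2r ?invr_gt0 ?pi_gt0//.
have cst : clip s <= clip t.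
  by rewrite /clip ge_max le_max lexx /= le_max le_min !ge_min lexx st !orbT.
have is_ := clip_itv s; have it := clip_itv t.
rewrite leNgt -ltr_cos ?in_itv/= ?acos_ge0 ?acos_lepi//.
by rewrite !acosK ?in_itv//= -leNgt.
Qed.

Lemma measurable_angle : measurable_fun setT angle.
Proof. exact: nonincreasing_measurable angle_nonincreasing. Qed.

End Angle.

Section ProductNull.
Context {R : realType}.
Local Notation Rm := (measurableTypeR R).
Local Notation mu := (@leb01 R).
Local Notation leb := (@lebesgue_measure R).

Lemma ae_fst (Q : R -> Prop) : {ae mu, forall x, Q x} ->
  {ae (mu \x mu)%E, forall z, Q z.1}.
Proof.
move=> [N [mN N0 QN]]; exists (N `*` setT); split.
- exact: measurableX.
- apply: (etrans (product_measure1E mu mu mN measurableT)).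
  change ((leb01 N * leb01 setT)%E = (0 : \bar R)%E).
  by rewrite [leb01 N]N0 mul0e.
- by move=> z nQ; split => //; exact: QN.
Qed.

Lemma ae_snd (Q : R -> Prop) : {ae mu, forall x, Q x} ->
  {ae (mu \x mu)%E, forall z, Q z.2}.
Proof.
move=> [N [mN N0 QN]]; exists (setT `*` N); split.
- exact: measurableX.
- apply: (etrans (product_measure1E mu mu measurableT mN)).
  change ((leb01 setT * leb01 N)%E = (0 : \bar R)%E).
  by rewrite [leb01 N]N0 mule0.
- by move=> z nQ; split => //; exact: QN.
Qed.

(** Inside the unit square the sections of a set have the same measure for leb01
and for the Lebesgue measure, so null sets of the first product are null for the
second. *)
Lemma ae_lebesgue_square (Q : R * R -> Prop) :
  {ae (mu \x mu)%E, forall z, Q z} ->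
  {ae (leb \x leb)%E, forall z : R * R, unitI z.1 -> unitI z.2 -> Q z}.
Proof.
move=> [N [mN N0 QN]]; have mU := @measurable_unitI R.
have mUU : measurable (@unitI R `*` @unitI R) by exact: measurableX.
pose M := N `&` (unitI `*` unitI).
have mM : measurable M by exact: measurableI.
exists M; split => //; last first.
  move=> z nQ; have [U1 U2] : unitI z.1 /\ unitI z.2.
    by split; apply: contrapT => nU; apply: nQ => *.
  by split => //; apply: QN => Qz; exact: nQ.
have M0 : (mu \x mu)%E M = 0%E.
  apply/eqP; rewrite -measure_le0 -N0; apply: le_measure; rewrite ?inE//.
  exact: subIsetl.
have secU x : xsection M x `<=` unitI.
  by move=> y; rewrite /xsection /= inE => -[_ []].
have mF : measurable_fun setT (mu \o xsection M).
  exact: measurable_fun_xsection.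
have F0 x : (0 <= (mu \o xsection M) x)%E by exact: measure_ge0.
have : (\int[mu]_x (mu \o xsection M) x = 0)%E by exact: M0.
move=> int0; change (\int[leb]_x (leb \o xsection M) x = 0)%E.
have -> : leb \o xsection M = (mu \o xsection M) \_ unitI.
  apply/funext => x; rewrite /patch; case: ifPn => xU /=.
    by change (leb (xsection M x) = leb (xsection M x `&` unitI)); rewrite setIidl.
  rewrite (_ : xsection M x = set0) ?measure0//.
  apply/seteqP; split => // y; rewrite /xsection /= inE => -[_ [U1 _]].
  by move/negP: xU; rewrite inE.
rewrite -integral_mkcond.
have -> : (\int[leb]_(x in unitI) (mu \o xsection M) x =
           \int[mu]_(x in unitI) (mu \o xsection M) x)%E.
  apply: eq_measure_integral => A mA AU.
  by change (leb A = leb (A `&` unitI)); rewrite setIidl.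
apply/eqP; rewrite eq_le; apply/andP; split; last by apply: integral_ge0.
rewrite -int0; apply: ge0_subset_integral => //.
Qed.

End ProductNull.

Theorem mainTheorem2 (R : realType) :
  exists (k : nat) (Fs : 'I_k -> sgraph),
    forall lambda : R, 0 < lambda <= 1 / 128 ->
    forall U : R -> R -> R, is_kernel U ->
      (forall i, hom_density (Fs i) U = hom_density (Fs i) (Wl lambda)) ->
      exists phi : R -> R,
        measure_preserving phi /\
        {ae (@lebesgue_measure R \x @lebesgue_measure R)%E, forall z : R * R,
           unitI z.1 -> unitI z.2 -> U z.1 z.2 = Wl lambda (phi z.1) (phi z.2)}.
Proof.
exists #|family_index 20|, (@graph_family 20) => lam lam01 U [mU [M UM] symU] dens.
have [lam0 lamle] := andP lam01.
have lam1 : 0 < lam < 1 by apply/andP; split => //; lra.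
have mI := @measurable_unitI R.
have mII : measurable (@unitI R `*` @unitI R) by exact: measurableX.
pose U0 x y := ((fun z : R * R => U z.1 z.2) \_ (unitI `*` unitI)) (x, y).
have U0E x y : unitI x -> unitI y -> U x y = U0 x y.
  by move=> Ix Iy; rewrite /U0 /patch mem_set.
have kU0 : total_kernel U0.
  split.
    split.
      have := (measurable_restrictT (fun z : R * R => U z.1 z.2) mII).1 mU.
      by apply: eq_measurable_fun => -[x y] _.
    exists `|M| => -[x y]; rewrite /U0 /patch /=; case: ifPn => [|_].
      by rewrite inE => -[/= Ix Iy]; rewrite (le_trans (UM _ _ Ix Iy))// ler_norm.
    by rewrite normr0.
  move=> x y; rewrite /U0 /patch !in_setX /= andbC.
  case: ifPn => // /andP[/set_mem Iy /set_mem Ix].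
  exact: symU.
have kW := total_kernel_Wl lam01.
have same : same_densities 20 U0 (Wl lam).
  by apply: (same_densities_of_family kU0 U0E kW).
pose mu := @leb01 R.
pose h := hdeg U0.
have mean0 : \int[mu]_x h x = 0 by rewrite (forced_mean kU0 kW same) mean_Wl.
have square : \int[mu]_x (h x * h x) = 1 / 2.
  by rewrite (forced_square kU0 kW same) square_Wl.
have eigen := forced_eigen kU0 kW same (eigen_defect_Wl lam01).
have dfct := forced_defect kU0 kW same (defect_Wl lam01).
have chebh := bint_cheb lam1 kU0 mean0 square eigen dfct.
pose c (x : R) := cos (pi * x).
have bc : bmeas (c : measurableTypeR R -> R).
  by apply: bmeas_cos_comp; exact: measurable_funM.
have bh : bmeas (h : measurableTypeR R -> R) by exact: bmeas_hdeg.
have chebc n : \int[mu]_x cheb n (c x) = (n == 0)%:R.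
  transitivity (\int[mu]_x cosn n x).
    by apply: eq_Rintegral => x _; rewrite cheb_cos.
  case: n => [|n]; last by rewrite bint_cosn.
  by rewrite -[RHS](bint_cst mu 1); apply: eq_Rintegral => x _; rewrite cosn0.
have law : forall A : set R, measurable A -> mu (h @^-1` A) = mu (c @^-1` A).
  apply: eq_law_of_moments => //; apply: moments_of_cheb => // n.
  by rewrite chebh chebc.
pose phi x := angle (h x).
exists phi; split.
  split.
  - by move=> x _; exact: angle_itv.
  - apply: measurable_funTS; apply: (measurableT_comp (@measurable_angle R)).
    exact: bh.1.
  - move=> A mA AI.
    have mB : measurable (angle @^-1` A : set R).
      by rewrite -[X in measurable X]setTI; exact: measurable_angle.
    have -> : lebesgue_measure (unitI `&` phi @^-1` A) = mu (h @^-1` (angle @^-1` A)).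
      by rewrite setIC.
    rewrite law//.
    change (lebesgue_measure ((c @^-1` (angle @^-1` A)) `&` unitI) = lebesgue_measure A).
    congr (lebesgue_measure _); apply/seteqP; split => x /=.
      by move=> [cA Ix]; rewrite -(angle_cos Ix).
    by move=> Ax; have Ix := AI _ Ax; rewrite /c angle_cos.
(* the set where |h| <= 1 is full because the law of h is that of a cosine *)
have hphi : {ae mu, forall x, h x = cos (pi * phi x)}.
  pose B : set R := ~` `[-1, 1].
  have mB : measurable B by apply: measurableC; exact: measurable_itv.
  exists (h @^-1` B); split.
  - by rewrite -[X in measurable X]setTI; exact: bh.1.
  - rewrite law// (_ : c @^-1` B = set0) ?measure0//.
    apply/seteqP; split => // x; rewrite /B /= in_itv/=.
    by rewrite cos_geN1 cos_le1.
  - move=> x nE; rewrite /B /= in_itv/= => h1; apply: nE.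
    by rewrite /= /phi cos_angle.
have aeE : {ae (mu \x mu)%E, forall z, U0 z.1 z.2 = Wl lam (phi z.1) (phi z.2)}.
  have := aeS2 (P := (mu \x mu)%E) (fun z (a : h z.1 = _) (b : h z.2 = _) => conj a b)
    (ae_fst hphi) (ae_snd hphi).
  apply: (aeS2 (P := (mu \x mu)%E)) dfct => z d0 [h1 h2].
  move: d0; rewrite /defect -/h h1 h2 -Wl_closed// => /eqP.
  rewrite subr_eq0 => /eqP /(mulIf _) E.
  have {}E := E (lt0r_neq0 (poisson_quad_gt0 lam01 _ _)).
  by move: E; rewrite /full_kernel; lra.
have [N [mN N0 QN]] := ae_lebesgue_square aeE.
exists N; split => // z nQ; apply: QN => zE; apply: nQ => I1 I2.
by rewrite U0E// zE.
Qed.
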